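(* Let $\Theta=(T,\{K_t\},\{\Sigma_e\},\{\phi_e\})$ be a tree system of metric compacta and let $\mathcal E=(\{\hat K_t\},\{\delta_e\})$ be a family of extended spaces and maps for $\Theta$ which is fine. Let $S_{\mathcal E}=(\{\hat K_F:F\in\mathcal F_T\},\{h_{F_1F_2}:F_1\subset F_2\})$ be the associated inverse system. Then $\lim\Theta$ is homeomorphic to the inverse limit $\varprojlim S_{\mathcal E}$; more precisely, the map sending a thread $(x_F)$ that eventually stabilizes at a point $y\in K_t$ to $y$, and a non-stabilizing thread to the corresponding end of $T$, is a homeomorphism $\varprojlim S_{\mathcal E}\to\lim\Theta$.
   Context: Trees: for a tree $T$, $V_T$ is its vertex set and $O_T$ its set of oriented edges; each $e\in O_T$ has initial vertex $\alpha(e)$, terminal vertex $\omega(e)$, and $\bar e$ denotes the oppositely oriented edge; $N_t=\{e\in O_T:\alpha(e)=t\}$. $\mathcal F_T$ is the poset (under inclusion) of finite subtrees of $T$. A family of subsets of a compact metric space is null if for every $\epsilon>0$ only finitely many of its members have diameter $\ge\epsilon$. A tree system of metric compacta is a tuple $\Theta=(T,\{K_t\},\{\Sigma_e\},\{\phi_e\})$ where $T$ is a countable tree, each $K_t$ is a compact metric space, each $\Sigma_e$ is a nonempty compact subset of $K_{\alpha(e)}$, each $\phi_e:\Sigma_e\to\Sigma_{\bar e}$ is a homeomorphism with $\phi_{\bar e}=\phi_e^{-1}$, and for each $t$ the family $\{\Sigma_e:e\in N_t\}$ consists of pairwise disjoint sets and is null in $K_t$. Limit: $E_T$ is the set of ends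 of $T$; $\#\Theta$ is the quotient of $\bigsqcup_tK_t$ by $x\sim\phi_e(x)$; as a set $\lim\Theta=\#\Theta\sqcup E_T$. For a finite subtree $F$, $K_F$ is the quotient of $\bigsqcup_{t\in V_F}K_t$ by $x\sim\phi_e(x)$ for edges $e$ of $F$; $N_F=\{e:\alpha(e)\in V_F,\omega(e)\notin V_F\}$; $U\subset K_F$ is saturated if each $\Sigma_e$ ($e\in N_F$) is contained in or disjoint from $U$; for saturated $U$, $G(U)$ is the union of $U$, of all $K_t$ ($t\notin V_F$) such that the shortest path from $F$ to $t$ starts with some $e\in N_F$ with $\Sigma_e\subset U$, and of all ends represented by rays starting in $F$, leaving $F$ immediately through such an edge $e$. The topology on $\lim\Theta$ has basis all $G(U)$ with $U$ open and saturated in some $K_F$. Extended spaces and maps: suppose for each $e\in O_T$ we are given a compact metric space $\Delta_e$, a compact subspace $S_e\subset\Delta_e$ and a homeomorphism $\varphi_e:S_e\to\Sigma_e$. For $t\in V_T$, the extended space $\hat K_t$ is the limit of the tree system over the star tree spanned by $t$ and its neighbours, with constituent spaces $K_t$ at $t$ and $\Delta_e$ at $\omega(e)$ ($e\in N_t$), peripheral subspaces $\Sigma_e\subset K_t$ and $S_e\subset\Delta_e$, connecting maps $\varphi_e^{-1}$ and $\varphi_e$. Thus $K_t$ and each $\Delta_e$ ($e\in N_t$) are subspaces of $\hat K_t$, with $S_e$ identified with $\Sigma_e$. Put $\hat K_e=\hat K_{\omega(e)}\setminus(\Delta_{\bar e}\setminus S_{\bar e})$. A family of extended spaces and maps is $\mathcal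 E=(\{\hat K_t\},\{\delta_e\})$ with continuous maps $\delta_e:\hat K_e\to\Delta_e$ whose restriction to $\Sigma_{\bar e}$ equals $\phi_{\bar e}$ (viewing $\Sigma_e=S_e\subset\Delta_e$). For $F\in\mathcal F_T$, $\hat K_F$ is the quotient of $\bigsqcup_{t\in V_F}\big[\hat K_t\setminus\bigcup_{e\in N_t\cap O_F}(\Delta_e\setminus S_e)\big]$ by $x\sim\phi_e(x)$, $e\in O_F$, $x\in\Sigma_e$. If $V_{F_2}=V_{F_1}\cup\{t\}$ and $e$ is the edge of $F_2$ with $\omega(e)=t$, then $h_{F_1F_2}:\hat K_{F_2}\to\hat K_{F_1}$ is the identity on $\hat K_{F_1}\setminus(\Delta_e\setminus S_e)$ and equals $\delta_e$ on $\hat K_e$; general $h_{F_1F_2}$ ($F_1\subset F_2$) are compositions of such maps along a chain of subtrees adding one vertex at a time (independent of the chain). The associated inverse system is $S_{\mathcal E}=(\{\hat K_F\},\{h_{F_1F_2}\})$ indexed by $\mathcal F_T$. For an embedded path $\gamma=(e_1,\dots,e_m)$ in $T$, $m\ge2$, let $\delta_\gamma=\delta_{e_1}\circ\dots\circ\delta_{e_{m-1}}|_{\Delta_{e_m}}:\Delta_{e_m}\to\Delta_{e_1}$ (note $\Delta_{e_{i+1}}\subset\hat K_{e_i}$). $\mathcal E$ is fine if for every $e\in O_T$ the family of sets $\delta_\gamma(\Delta_{e_m})$, over all such paths $\gamma$ with $e_1=e$, is null in $\Delta_e$. *)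

(* Defs.v *)
From HB Require Import structures.
From mathcomp Require Import all_boot all_order all_algebra.
From mathcomp Require Import all_classical all_reals topology.
From Stdlib Require Import Relations.
From Stdlib Require List.
Unset Printing Implicit Defensive.
Import Order.TTheory GRing.Theory Num.Theory.
Local Open Scope classical_set_scope.
Local Open Scope ring_scope.

Definition qt {A : Type} (r : A -> A -> Prop) := {C : set A | exists a, C = r a}.
Definition qcl {A : Type} (r : A -> A -> Prop) (a : A) : qt r :=
  exist _ (r a) (ex_intro _ a erefl).

Fixpoint all_in {T : Type} (A : set T) (s : seq T) : Prop :=
  match s with nil => True | y :: s' => A y /\ all_in A s' end.

Definition homeo {A B : Type} (openA : set (set A)) (openB : set (set B))
  (f : A -> B) :=
  bijective f /\ (forall O, openB O -> openA (f @^-1` O))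
              /\ (forall O, openA O -> openB (f @` O)).

(* Raw data of a tree system: a tree given by vertices V, oriented     *)
(* edges E, initial vertex alpha, reversal rev (terminal vertex is     *)
(* alpha (rev e)), constituent spaces K, peripheral subspaces Sig, and *)
(* the gluing as a relation between Sig e and Sig (rev e).            *)
Record tdata (R : realType) := TData {
  tV : Type; tE : Type;
  talpha : tE -> tV; trev : tE -> tE;
  tK : tV -> pseudoMetricType R;
  tSig : forall e, set (tK (talpha e));
  tG : forall e, tK (talpha e) -> tK (talpha (trev e)) -> Prop }.
Arguments tV {R} t. Arguments tE {R} t. Arguments talpha {R} t _.
Arguments trev {R} t _. Arguments tK {R} t _. Arguments tSig {R} t e _.
Arguments tG {R} t e _ _.

Section Limit.
Context {R : realType} (D : tdata R).

Definition tomega (e : tE D) := talpha D (trev D e).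
Definition adj (u v : tV D) := exists e, talpha D e = u /\ tomega e = v.
Fixpoint is_walk (x : tV D) (s : seq (tV D)) : Prop :=
  match s with nil => True | y :: s' => adj x y /\ is_walk y s' end.

Definition is_tree :=
  countable [set: tV D] /\ inhabited (tV D) /\
  (forall e, trev D (trev D e) = e) /\
  (forall e, talpha D e <> tomega e) /\
  (forall e1 e2, talpha D e1 = talpha D e2 -> tomega e1 = tomega e2 -> e1 = e2) /\
  (forall u v, exists s, is_walk u s /\ last u s = v) /\
  (forall x s, is_walk x s -> List.NoDup (x :: s) -> (2 <= size s)%N ->
     ~ adj (last x s) x).

(* finite subtrees, identified with their (finite, nonempty, connected) vertex sets *)
Definition fsubtree (F : set (tV D)) :=
  finite_set F /\ F !=set0 /\
  forall u v, F u -> F v -> exists s, is_walk u s /\ last u s = v /\ all_in F s.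

Definition Pt := {v : tV D & tK D v}.
Definition glue_in (F : set (tV D)) (p q : Pt) : Prop :=
  exists e x y, F (talpha D e) /\ F (tomega e) /\ tG D e x y /\
    p = existT _ (talpha D e) x /\ q = existT _ (talpha D (trev D e)) y.
Definition equivF (F : set (tV D)) := clos_refl_sym_trans Pt (glue_in F).

Definition is_ray (r : nat -> tV D) := (forall n, adj (r n) (r n.+1)) /\ injective r.
Definition Ray := {r : nat -> tV D | is_ray r}.
Definition ray_eq (r1 r2 : Ray) := exists i j, forall n, sval r1 (i + n)%N = sval r2 (j + n)%N.
Definition End := qt ray_eq.

Definition LimPt := (qt (equivF setT) + End)%type.

Definition NF (F : set (tV D)) e := F (talpha D e) /\ ~ F (tomega e).
Definition sliceU (U : set Pt) (v : tV D) : set (tK D v) := [set x | U (existT _ v x)].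
(* t lies beyond the edge e leaving F (the shortest path from F to t starts with e) *)
Definition beyond (F : set (tV D)) e t :=
  exists s, is_walk (tomega e) s /\ last (tomega e) s = t /\ all_in (~` F) (tomega e :: s).

(* U (as an F-saturated subset of the disjoint union of the K_t, t in F)
   is open and saturated in K_F *)
Definition basic_ok (F : set (tV D)) (U : set Pt) :=
  fsubtree F /\ (forall p, U p -> F (projT1 p)) /\
  (forall p q, U p -> equivF F p q -> U q) /\
  (forall v, F v -> open (sliceU U v)) /\
  (forall e, NF F e -> tSig D e `<=` sliceU U (talpha D e) \/
                       tSig D e `&` sliceU U (talpha D e) = set0).

Definition Gset (F : set (tV D)) (U : set Pt) : set LimPt := fun z =>
  match z with
  | inl c => exists p, sval c p /\
      (U p \/ exists e, NF F e /\ tSig D e `<=` sliceU U (talpha D e) /\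
                        beyond F e (projT1 p))
  | inr xi => exists r, sval xi r /\
      exists e, NF F e /\ tSig D e `<=` sliceU U (talpha D e) /\
                sval r 0%N = talpha D e /\ sval r 1%N = tomega e
  end.

Definition lim_open (W : set LimPt) :=
  forall z, W z -> exists F U, basic_ok F U /\ Gset F U z /\ Gset F U `<=` W.
End Limit.

Definition null_fam {R : realType} {T : pseudoMetricType R} {I : Type}
  (A : I -> set T) :=
  forall eps : R, 0 < eps ->
    finite_set [set i | exists x y, A i x /\ A i y /\ ~ ball x eps y].

Definition homeo_on {A B : topologicalType} (X : set A) (Y : set B) (f : A -> B) :=
  {within X, continuous f} /\ (forall x, X x -> Y (f x)) /\
  exists g : B -> A, {within Y, continuous g} /\
    (forall y, Y y -> X (g y) /\ f (g y) = y) /\ (forall x, X x -> g (f x) = x).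

(* a set A in K a, seen inside K v (meaningful when a = v) *)
Definition at_v {V : Type} (K : V -> Type) (v : V) {a : V} (A : set (K a)) : set (K v) :=
  [set x | exists y, A y /\ existT K a y = existT K v x].

Record theta (R : realType) := Theta {
  Vert : Type; Edge : Type; alpha : Edge -> Vert; rev : Edge -> Edge;
  K : Vert -> pseudoMetricType R;
  Sig : forall e, set (K (alpha e));
  phi : forall e, K (alpha e) -> K (alpha (rev e)) }.
Arguments Vert {R} t. Arguments Edge {R} t. Arguments alpha {R} t _.
Arguments rev {R} t _. Arguments K {R} t _. Arguments Sig {R} t e _.
Arguments phi {R} t e _.

Section Theta.
Context {R : realType} (Th : theta R).

Definition omega (e : Edge Th) := alpha Th (rev Th e).

Definition thdata : tdata R :=
  @TData R (Vert Th) (Edge Th) (alpha Th) (rev Th) (K Th) (Sig Th)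
    (fun e x y => Sig Th e x /\ y = phi Th e x).

Definition tree_system :=
  is_tree thdata /\
  (forall v, hausdorff_space (K Th v) /\ compact [set: K Th v]) /\
  (forall e, compact (Sig Th e) /\ Sig Th e !=set0) /\
  (forall e, homeo_on (Sig Th e) (Sig Th (rev Th e)) (phi Th e)) /\
  (forall e x, Sig Th e x ->
     existT (K Th) (alpha Th (rev Th (rev Th e))) (phi Th (rev Th e) (phi Th e x))
     = existT (K Th) (alpha Th e) x) /\
  (forall e1 e2 x1 x2, Sig Th e1 x1 -> Sig Th e2 x2 ->
     existT (K Th) (alpha Th e1) x1 = existT (K Th) (alpha Th e2) x2 -> e1 = e2) /\
  (forall v, null_fam (fun e : {e : Edge Th | alpha Th e = v} =>
                         at_v (K Th) v (Sig Th (sval e)))).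

Record extsp := ExtSp {
  Delta : Edge Th -> pseudoMetricType R;
  Sper : forall e, set (Delta e);
  varphi : forall e, Delta e -> K Th (alpha Th e) }.

Definition ext_ok (X : extsp) :=
  forall e, hausdorff_space (Delta X e) /\ compact [set: Delta X e] /\
    compact (Sper X e) /\ homeo_on (Sper X e) (Sig Th e) (varphi X e).

Section Star.
Variables (X : extsp) (t : Vert Th).
Definition Nt := {e : Edge Th | alpha Th e = t}.
Definition starK (o : option Nt) : pseudoMetricType R :=
  match o with None => K Th t | Some e => Delta X (sval e) end.
Definition star_alpha (b : bool * Nt) : option Nt :=
  if b.1 then None else Some b.2.
Definition star_rev (b : bool * Nt) : bool * Nt := (~~ b.1, b.2).
Definition starSig (b : bool * Nt) : set (starK (star_alpha b)) :=
  match b as b0 return set (starK (star_alpha b0)) with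
  | (true, e) => at_v (K Th) t (Sig Th (sval e))
  | (false, e) => Sper X (sval e)
  end.
Definition starG (b : bool * Nt) :
  starK (star_alpha b) -> starK (star_alpha (star_rev b)) -> Prop :=
  match b as b0 return starK (star_alpha b0) -> starK (star_alpha (star_rev b0)) -> Prop with
  | (true, e) => fun x y => Sper X (sval e) y /\
       existT (K Th) (alpha Th (sval e)) (varphi X (sval e) y) = existT (K Th) t x
  | (false, e) => fun y x => Sper X (sval e) y /\
       existT (K Th) (alpha Th (sval e)) (varphi X (sval e) y) = existT (K Th) t x
  end.
Definition star : tdata R :=
  @TData R (option Nt) (bool * Nt) star_alpha star_rev starK starSig starG.
Definition hatK := LimPt star.
Definition hat_open := @lim_open R star.
Definition kpt (y : K Th t) : hatK :=
  inl (qcl (equivF star setT) (existT (tK star) None y)).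
Definition dpt (e : Nt) (s : Delta X (sval e)) : hatK :=
  inl (qcl (equivF star setT) (existT (tK star) (Some e) s)).
End Star.

Definition dpt' (X : extsp) (e : Edge Th) (s : Delta X e) : hatK X (alpha Th e) :=
  @dpt X (alpha Th e) (exist _ e erefl) s.

Definition hatKe (X : extsp) (e : Edge Th) : set (hatK X (omega e)) :=
  [set z | ~ exists y, ~ Sper X (rev Th e) y /\ z = dpt' X (rev Th e) y].

Definition cont_within {A : Type} {B : topologicalType} (openA : set (set A))
  (Y : set A) (f : A -> B) :=
  forall O, open O -> exists W, openA W /\ forall z, Y z -> (W z <-> O (f z)).

Definition ext_family (X : extsp)
  (delta : forall e : Edge Th, hatK X (omega e) -> Delta X e) :=
  ext_ok X /\
  forall e, cont_within (hat_open X (omega e)) (hatKe X e) (delta e) /\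
    forall x : K Th (alpha Th (rev Th e)), Sig Th (rev Th e) x ->
      Sper X e (delta e (kpt X _ x)) /\
      existT (K Th) (alpha Th e) (varphi X e (delta e (kpt X _ x)))
      = existT (K Th) (alpha Th (rev Th (rev Th e))) (phi Th (rev Th e) x).

Section Fine.
Variables (X : extsp) (delta : forall e : Edge Th, hatK X (omega e) -> Delta X e).

Fixpoint consec (e : Edge Th) (l : seq (Edge Th)) : Prop :=
  match l with nil => True | e' :: l' => omega e = alpha Th e' /\ consec e' l' end.
Definition epath (e : Edge Th) (l : seq (Edge Th)) :=
  consec e l /\ List.NoDup (alpha Th e :: omega e :: map omega l).

(* dimg e l = delta_gamma(Delta_{e_m}) for gamma = e :: l *)
Fixpoint dimg (e : Edge Th) (l : seq (Edge Th)) : set (Delta X e) :=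
  match l with
  | nil => setT
  | e' :: l' => [set delta e z | z in
       [set z : hatK X (omega e) | exists s, dimg e' l' s /\
          existT (hatK X) (omega e) z = existT (hatK X) (alpha Th e') (dpt' X e' s)]]
  end.

Definition fine_family :=
  forall e, null_fam (fun l : {l : seq (Edge Th) | l <> nil /\ epath e l} =>
                        dimg e (sval l)).

Definition HP := {t : Vert Th & hatK X t}.
Definition Yset (F : set (Vert Th)) (t : Vert Th) (z : hatK X t) : Prop :=
  ~ exists (e : Nt t) y, F (omega (sval e)) /\ ~ Sper X (sval e) y /\ z = dpt X t e y.
Definition Piece (F : set (Vert Th)) := {p : HP | F (projT1 p) /\ Yset F (projT1 p) (projT2 p)}.
Definition hglue (F : set (Vert Th)) (p q : Piece F) : Prop :=
  exists e x, F (alpha Th e) /\ F (omega e) /\ Sig Th e x /\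
    sval p = existT (hatK X) (alpha Th e) (kpt X _ x) /\
    sval q = existT (hatK X) (alpha Th (rev Th e)) (kpt X _ (phi Th e x)).
Definition HatF (F : set (Vert Th)) := qt (clos_refl_sym_trans _ (hglue F)).
Definition hclass (F : set (Vert Th)) (p : Piece F) : HatF F := qcl _ p.
(* quotient topology of the disjoint union of the subspaces of the hat K_t *)
Definition hatF_open (F : set (Vert Th)) (W : set (HatF F)) :=
  exists O : forall t, set (hatK X t),
    (forall t, F t -> hat_open X t (O t)) /\
    forall p : Piece F, W (hclass F p) <-> O _ (projT2 (sval p)).

(* h_{F1 F2} when V_{F2} = V_{F1} u {omega e}, alpha e in F1 *)
Definition hrel (F1 F2 : set (Vert Th)) (e : Edge Th) (x2 : HatF F2) (x1 : HatF F1) :=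
  exists (p2 : Piece F2) (p1 : Piece F1), x2 = hclass F2 p2 /\ x1 = hclass F1 p1 /\
    ((F1 (projT1 (sval p2)) /\ sval p1 = sval p2) \/
     (exists z, hatKe X e z /\ sval p2 = existT (hatK X) (omega e) z /\
        sval p1 = existT (hatK X) (alpha Th e) (dpt' X e (delta e z)))).

Definition FT := {F : set (Vert Th) | fsubtree thdata F}.
Definition compatible (x : forall F : FT, HatF (sval F)) :=
  forall (F1 F2 : FT) e, sval F1 (alpha Th e) -> ~ sval F1 (omega e) ->
    sval F2 = sval F1 `|` [set omega e] -> hrel (sval F1) (sval F2) e (x F2) (x F1).
Definition Thr := {x : forall F : FT, HatF (sval F) | compatible x}.
Definition thr_open (A : set Thr) :=
  forall x, A x -> exists (Fs : set FT) (W : forall F : FT, set (HatF (sval F))),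
    finite_set Fs /\ (forall F, Fs F -> hatF_open (sval F) (W F)) /\
    (forall F, Fs F -> W F (sval x F)) /\
    (forall y : Thr, (forall F, Fs F -> W F (sval y F)) -> A y).

Definition stab (x : Thr) (t : Vert Th) (y : K Th t) :=
  exists F0 : FT, forall F : FT, sval F0 `<=` sval F ->
    exists p : Piece (sval F),
      sval p = existT (hatK X) t (kpt X _ y) /\ sval x F = hclass (sval F) p.
Definition corr (x : Thr) (xi : End thdata) :=
  forall F : FT, exists e, NF thdata (sval F) e /\
    (exists (p : Piece (sval F)) s,
       sval p = existT (hatK X) (alpha Th e) (dpt' X e s) /\ sval x F = hclass (sval F) p) /\
    exists r, sval xi r /\ sval r 0%N = alpha Th e /\ sval r 1%N = omega e.
End Fine.
End Theta.

(* Main.v *)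
Require Import Defs.
From mathcomp Require Import all_boot all_order all_algebra.
From mathcomp Require Import all_classical all_reals interval_inference topology.
From Stdlib Require Import Relations.
From Stdlib Require List.
Unset Printing Implicit Defensive.
Import Order.TTheory GRing.Theory Num.Theory.
Local Open Scope classical_set_scope.
Local Open Scope ring_scope.

(** A flow is an orientation of the edges of the tree with at most one edge leaving each
    vertex. A flow either has a sink or determines an end of [T], and for every finite subtree
    [F] there is a unique vertex of [F], the gate, from which no edge of the flow stays in [F].
    If at some [F] a thread lies off the [Delta_e] with [e] leaving [F], then it is constant from
    [F] on. Otherwise its coordinate at every [F] lies in a single [Delta_e] with [e] leaving [F],
    and these edges form a flow without sink, hence an end. Conversely a flow together with a
    choice of points compatible with the maps [delta_e] gives a thread, whose coordinate at [F]
    is the point at the gate. For an end, fineness and compactness provide exactly one such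
    choice: the intersection of the closures of the sets [delta_gamma(Delta)] along the ray is
    a single point.

    For the topologies, the limit of a thread lies in [G(U)] if and only if its coordinate at [F]
    lies in the union of [U] and of the [Delta_e] with [Sigma_e] contained in [U], which is open
    in [hat K_F]. Conversely, every open set of [hat K_F] containing the coordinate of a thread
    can be pulled back to a larger subtree and shrunk there to a set of this form; at an end
    this uses that the images of the [Delta_e] along the ray become small. *)

(** * Trees *)

(** The spaces [hat K_F] are quotients whose carriers change with [F], and a thread only comes with
    compatibility for the addition of one vertex. The proof therefore works with representatives in
    the single type [HP]: the identification [hq] and the maps [foldp] make sense there without
    reference to [F], and a coordinate is handled through the relation [thpt]. Statements about
    nested subtrees follow by induction on single vertices.

    Flows treat vertices and ends alike. The thread of a point over [t] is represented at [F] over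
    the vertex of [F] nearest to [t]; an end also has a nearest vertex in each [F]. The gate is this
    vertex in both cases, so a single construction produces all threads.

    The trace of [G(U)] on [hat K_F] contains each [Delta_e] with [e] leaving [F] either wholly or,
    off [Sigma_e], not at all. An open set of [hat K_F] that cuts through some [Delta_e] thus has no
    counterpart over [F] itself; this is what forces the passage to larger subtrees. *)

Lemma all_inP {T : Type} (A : set T) (s : seq T) :
  all_in A s <-> forall x, List.In x s -> A x.
Proof.
elim: s => [|y s IH] /=; first by split.
split=> [[Ay /IH As] x [<-//|/As//]|As].
by split; [apply: As; left|apply/IH => x xs; apply: As; right].
Qed.

Lemma In_last {T : Type} (x : T) s : List.In (last x s) (x :: s).
Proof. by elim: s x => [|y s IH] x; [left|right; exact: IH]. Qed.

Lemma finite_list {T : Type} (A : set T) : finite_set A ->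
  exists s, forall x, A x -> List.In x s.
Proof.
move=> /(@finite_seqP {classic T})[s ->]; exists s => x.
elim: s => [|y s IH] //=; rewrite inE => /orP[/eqP->|/IH ?]; [by left|by right].
Qed.

Section Tree.
Context {R : realType} {D : tdata R} (HT : is_tree D).
Local Notation al := (talpha D).
Local Notation om := (tomega D).
Local Notation walk := (is_walk D).

Lemma trevK e : trev D (trev D e) = e.
Proof. by case: HT => _ [_ [->]]. Qed.

Lemma talpha_tomega e : al e <> om e.
Proof. by case: HT => _ [_ [_ [/(_ e)]]]. Qed.

Lemma tedge_inj e1 e2 : al e1 = al e2 -> om e1 = om e2 -> e1 = e2.
Proof. by case: HT => _ [_ [_ [_ [/(_ e1 e2)]]]]. Qed.

Lemma tomega_rev e : om (trev D e) = al e.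
Proof. by rewrite /tomega trevK. Qed.

Lemma tree_connected u v : exists s, walk u s /\ last u s = v.
Proof. by case: HT => _ [_ [_ [_ [_ [/(_ u v)]]]]]. Qed.

Lemma tree_acyclic x s : walk x s -> List.NoDup (x :: s) -> (2 <= size s)%N ->
  ~ adj D (last x s) x.
Proof. by case: HT => _ [_ [_ [_ [_ [_ H]]]]]; exact: H. Qed.

Lemma adj_edge e : adj D (al e) (om e).
Proof. by exists e. Qed.

Lemma adj_sym u v : adj D u v -> adj D v u.
Proof. by case=> e [<- <-]; exists (trev D e); rewrite tomega_rev. Qed.

Lemma walk_cat u s1 s2 : walk u (s1 ++ s2) <-> walk u s1 /\ walk (last u s1) s2.
Proof.
elim: s1 u => [|y s IH] u /=; first by split=> [|[]].
split; first by case=> ? /IH [].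
by case=> [[? ?] ?]; split=> //; apply/IH.
Qed.

(** Loop erasure: if the start reappears in the simple walk already obtained for the rest,
    everything up to that occurrence is dropped. *)
Lemma walk_simple u s : walk u s -> exists s',
  [/\ walk u s', last u s' = last u s, (forall z, List.In z s' -> List.In z s) & List.NoDup (u :: s')].
Proof.
elim: s u => [|y s IH] u /=.
  move=> _; exists [::]; split=> //.
  by apply: List.NoDup_cons; [case|exact: List.NoDup_nil].
case=> uy /IH [s' [ws' ls' ss' nd]].
have [uin|unin] := EM (List.In u (y :: s')).
  have [l1 [l2 e12]] := List.in_split _ _ uin.
  have lE : last y s' = last u l2.
    by have := congr1 (last y) e12; rewrite /= last_cat.
  have wl2 : walk u l2.
    case: l1 e12 => [|a l1] /= [yu e2] //.
      by rewrite -e2 -yu.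
    by move: ws'; rewrite e2 => /walk_cat [_ []].
  exists l2; split=> //; first by rewrite -lE.
    move=> z zl2.
    have : List.In z (y :: s').
      by rewrite e12; apply: List.in_or_app; right; right.
    by case=> [->|/ss' ?]; [left|right].
  by move: nd; rewrite e12 => /List.NoDup_app_remove_l.
exists (y :: s'); split=> //=.
  by move=> z [->|/ss' ?]; [left|right].
by constructor.
Qed.

Definition tconn (F : set (tV D)) :=
  forall u v, F u -> F v -> exists s, walk u s /\ last u s = v /\ all_in F s.

(** Two distinct neighbours of [v] in [F], joined by a simple walk inside [F], would close a cycle
    through [v]. *)
Lemma tconn_edge_unique F a b v :
  tconn F -> F a -> F b -> ~ F v -> adj D v a -> adj D b v -> a = b.
Proof.
move=> cF Fa Fb Fv va bv.
have [s [ws [ls /all_inP Fs]]] := cF _ _ Fa Fb.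
have [s' [ws' ls' ss' nd]] := walk_simple _ _ ws.
case: s' ws' ls' ss' nd => [|c s'] ws' ls' ss' nd.
  by rewrite -ls -ls'.
exfalso.
apply: (@tree_acyclic v (a :: c :: s')) => //.
- constructor=> //.
  by case=> [eva|/ss' /Fs//]; apply: Fv; rewrite -eva.
- by rewrite /= in ls' *; rewrite ls' ls.
Qed.

Lemma walk_conn u s : walk u s -> tconn [set x | List.In x (u :: s)].
Proof.
suff H : walk u s -> forall x, List.In x (u :: s) ->
   (exists t, [/\ walk u t, last u t = x & (forall z, List.In z t -> List.In z (u :: s))]) /\
   (exists t, [/\ walk x t, last x t = u & (forall z, List.In z t -> List.In z (u :: s))]).
  move=> ws x y xs ys.
  have [_ [t1 [w1 l1 i1]]] := H ws x xs.
  have [[t2 [w2 l2 i2]] _] := H ws y ys.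
  exists (t1 ++ t2); split; first by apply/walk_cat; rewrite l1.
  split; first by rewrite last_cat l1.
by apply/all_inP => z /(@List.in_app_or _ _ _ _)[zt|zt]; [exact: i1|exact: i2].
elim: s u => [|v s IH] u /=.
  by move=> _ x [<-|//]; split; exists [::]; split=> // z [].
case=> uv ws x [<-|xs].
  by split; exists [::]; split=> // z [].
have [[t1 [w1 l1 i1]] [t2 [w2 l2 i2]]] := IH _ ws x xs.
split.
  exists (v :: t1); split=> // z [->|/i1]; first by right; left.
  by right.
exists (t2 ++ [:: u]); split.
- by apply/walk_cat; rewrite l2; split=> //; split=> //; exact: adj_sym.
- by rewrite last_cat.
- by move=> z /(@List.in_app_or _ _ _ _)[zt|[->|//]]; [right; exact: i2|left].
Qed.

Lemma tconnU F G x : tconn F -> tconn G -> F x -> G x -> tconn (F `|` G).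
Proof.
move=> cF cG Fx Gx.
have H u : (F `|` G) u -> (exists s, walk u s /\ last u s = x /\ all_in (F `|` G) s)
    /\ (exists s, walk x s /\ last x s = u /\ all_in (F `|` G) s).
  case=> Hu.
    have [s1 [? [? /all_inP A1]]] := cF _ _ Hu Fx.
    have [s2 [? [? /all_inP A2]]] := cF _ _ Fx Hu.
    split; [exists s1|exists s2]; split=> //; split=> //; apply/all_inP => z Hz; left;
      [exact: A1|exact: A2].
  have [s1 [? [? /all_inP A1]]] := cG _ _ Hu Gx.
  have [s2 [? [? /all_inP A2]]] := cG _ _ Gx Hu.
  split; [exists s1|exists s2]; split=> //; split=> //; apply/all_inP => z Hz; right;
    [exact: A1|exact: A2].
move=> u v /H[[s1 [w1 [l1 /all_inP A1]]] _] /H[_ [s2 [w2 [l2 /all_inP A2]]]].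
exists (s1 ++ s2); split; first by apply/walk_cat; rewrite l1.
split; first by rewrite last_cat l1.
by apply/all_inP => z /(@List.in_app_or _ _ _ _)[/A1|/A2].
Qed.

(** The two tails share their last vertex, so together they form a connected set avoiding [x]; such
    a set contains only one neighbour of [x], and the first steps agree. *)
Lemma simple_walk_unique x s s' : walk x s -> walk x s' -> last x s = last x s' ->
  List.NoDup (x :: s) -> List.NoDup (x :: s') -> s = s'.
Proof.
elim: s x s' => [|a s IH] x [|b s'] //=.
- by move=> _ _ lE _ nd; inversion nd; exfalso; apply: H1; rewrite lE; exact: In_last.
- by move=> _ _ lE nd; inversion nd; exfalso; apply: H1; rewrite -lE; exact: In_last.
move=> [xa ws] [xb ws'] lE nd nd'.
have ab : a = b.
  inversion nd; inversion nd'; subst.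
  have := @tconn_edge_unique ([set z | List.In z (a :: s)] `|` [set z | List.In z (b :: s')])
     a b x.
  apply=> //.
  - apply: (@tconnU _ _ (last a s)); [exact: walk_conn|exact: walk_conn|exact: In_last|].
    by rewrite lE; exact: In_last.
  - by left; left.
  - by right; left.
  - by case.
  - exact: adj_sym.
subst b; congr cons; apply: (IH a) => //; by [inversion nd|inversion nd'].
Qed.

Lemma fsubtree1 v : fsubtree D [set v].
Proof.
split; first exact: finite_set1.
split; first by exists v.
by move=> u w -> ->; exists [::].
Qed.

Lemma tconn_add F e : tconn F -> F (al e) -> tconn (F `|` [set om e]).
Proof.
move=> cF Fe.
have -> : F `|` [set om e] = F `|` [set z | List.In z [:: al e; om e]].
  rewrite eqEsubset; split=> z [Fz|]; [by left|by move=> ->; right; right; left|by left|].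
  by case=> [<-|[<-|//]]; [left|right].
apply: (@tconnU _ _ (al e)) => //; last by left.
by apply: walk_conn; split=> //; exact: adj_edge.
Qed.

Lemma fsubtree_add F e : fsubtree D F -> F (al e) -> fsubtree D (F `|` [set om e]).
Proof.
move=> [fF [[x Fx] cF]] Fe; split; first by rewrite finite_setU; split.
split; first by exists x; left.
exact: tconn_add.
Qed.

Lemma fsubtree_edge e : fsubtree D ([set al e] `|` [set om e]).
Proof. by apply: fsubtree_add => //; exact: fsubtree1. Qed.

Lemma finite_set_In {T : Type} (s : seq T) : finite_set [set x | List.In x s].
Proof.
elim: s => [|y s IH]; first by rewrite (_ : [set _ | _] = set0) // -subset0.
rewrite (_ : [set _ | _] = [set y] `|` [set x | List.In x s]).
  by rewrite finite_setU.
by rewrite eqEsubset; split=> z [->|]; [left|right|left|right].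
Qed.

Lemma fsubtreeU F G : fsubtree D F -> fsubtree D G ->
  exists H, [/\ fsubtree D H, F `<=` H & G `<=` H].
Proof.
move=> [fF [[x Fx] cF]] [fG [[y Gy] cG]].
have [s [ws ls]] := tree_connected x y.
exists (F `|` [set z | List.In z (x :: s)] `|` G); split.
- split; first by rewrite finite_setU; split=> //; rewrite finite_setU; split=> //; exact: (finite_set_In (x :: s)).
  split; first by exists x; left; left.
  apply: (@tconnU _ _ y) => //; last by right; rewrite -ls; exact: In_last.
  by apply: (@tconnU _ _ x) => //; [exact: walk_conn|left].
- by move=> z Fz; left; left.
- by move=> z Gz; right.
Qed.

Lemma walk_exit F u s : F u -> ~ F (last u s) -> walk u s ->
  exists e, [/\ F (al e), ~ F (om e) & List.In (om e) s].
Proof.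
elim: s u => [|v s IH] u //= Fu Fl [[e [eu ev]] ws].
have [Fv|Fv] := EM (F v).
  have [f [f1 f2 f3]] := IH v Fv Fl ws.
  by exists f; split=> //; right.
by exists e; split; rewrite ?eu ?ev //; left.
Qed.

(* Between nested subtrees one can pass by adding one vertex at a time. *)
Lemma fsubtree_down (P : set (tV D) -> Prop) F1 F2 :
  fsubtree D F1 -> fsubtree D F2 -> F1 `<=` F2 -> P F2 ->
  (forall F e, fsubtree D F -> F1 `<=` F -> F `|` [set om e] `<=` F2 -> NF D F e ->
     P (F `|` [set om e]) -> P F) -> P F1.
Proof.
move=> tF1 tF2 F12 PF2 step.
have [L F2L] := finite_list _ (proj1 tF2).
(* The induction measure: [L] lists at least the vertices of [F2] still missing from [F]. *)
suff H n : forall F L, (size L <= n)%N -> fsubtree D F -> F1 `<=` F -> F `<=` F2 ->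
    (forall v, F2 v -> ~ F v -> List.In v L) -> P F.
  by apply: (H _ F1 L (leqnn _)) => // v /F2L.
elim: n => [|n IH] {L F2L} F L sL tF F1F FF2 F2L.
  suff -> : F = F2 by [].
  rewrite eqEsubset; split=> // v F2v; apply: contrapT => Fv.
  by case: L sL F2L => // _ /(_ v F2v Fv).
have [F2F|/existsNP [v /not_implyP [F2v Fv]]] := EM (F2 `<=` F).
  by have -> : F = F2 by rewrite eqEsubset.
have [_ [[x Fx] _]] := tF.
have [_ [_ cF2]] := tF2.
have [s [ws [ls /all_inP F2s]]] := cF2 _ _ (FF2 _ Fx) F2v.
have [|e [Fe nFe es]] := @walk_exit F x s Fx _ ws; first by rewrite ls.
have F2e : F2 (om e) by exact: F2s.
have tF' := fsubtree_add F e tF Fe.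
have FF2' : F `|` [set om e] `<=` F2 by move=> z [/FF2//|->].
have [l1 [l2 LE]] := List.in_split _ _ (F2L _ F2e nFe).
apply: (step F e) => //; apply: (IH _ (l1 ++ l2)) => //.
- move: sL; rewrite LE (_ : (_ ++ _)%list = l1 ++ om e :: l2) //.
  by rewrite !size_cat /= addnS.
- by move=> z /F1F; left.
- move=> z F2z nz.
  have : List.In z L by apply: F2L => // Fz; apply: nz; left.
  rewrite LE => /(@List.in_app_or _ _ _ _)[?|[ez|?]].
  + by apply: List.in_or_app; left.
  + by exfalso; apply: nz; right.
  + by apply: List.in_or_app; right.
Qed.

Lemma fsubtree_up (P : set (tV D) -> Prop) F1 F2 :
  fsubtree D F1 -> fsubtree D F2 -> F1 `<=` F2 -> P F1 ->
  (forall F e, fsubtree D F -> F1 `<=` F -> F `|` [set om e] `<=` F2 -> NF D F e ->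
     P F -> P (F `|` [set om e])) -> P F2.
Proof.
move=> t1 t2 F12 PF1 step.
(* Upward induction is downward induction for the predicate [P F -> P F2]. *)
apply: (@fsubtree_down (fun F => P F -> P F2) F1 F2) => // F e tF F1F FF2 NFe H PF.
by apply: H; apply: step.
Qed.

(** The edge is the one by which a walk from [F] to [t] leaves [F] for the last time. *)
Lemma beyond_exists F t : fsubtree D F -> ~ F t -> exists e, NF D F e /\ beyond D F e t.
Proof.
move=> [_ [[x Fx] _]] Ft.
have [s [ws ls]] := tree_connected x t.
elim: s x Fx ws ls => [|y s IH] x Fx /=; first by move=> _ xt; subst.
move=> [[e [ex ey]] ws] ls.
have [[z [zs Fz]]|nz] := EM (exists z, List.In z (y :: s) /\ F z); last first.
  exists e; split; first by split; rewrite ?ex ?ey // => Fy; apply: nz; exists y; split=> //; left.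
  exists s; rewrite ey; split=> //; split=> //.
  by apply/all_inP => z zs Fz; apply: nz; exists z.
have [Fy|Fy] := EM (F y); first exact: (IH y).
case: zs => [yz|zs]; first by subst.
(* restart from the last visit of [F] *)
move: {IH} s y ws ls Fy zs {e ex ey x Fx} => s y ws ls _ zs.
elim: s y ws ls z zs Fz => [|a s IH] y //= [[e [ey ea]] ws] ls z zs Fz.
have [[z' [zs' Fz']]|nz] := EM (exists z, List.In z s /\ F z); first by apply: (IH a ws ls z').
have za : a = z by case: zs => // zs; exfalso; apply: nz; exists z.
subst z.
case: s {IH zs} ws ls nz => [|b s] /=; first by move=> _ ta; subst.
move=> [[f [fa fb]] ws] ls nz.
exists f; split; first by split; rewrite ?fa ?fb // => Fb; apply: nz; exists b; split=> //; left.
exists s; rewrite fb; split=> //; split=> //.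
by apply/all_inP => w wbs Fw; apply: nz; exists w.
Qed.

(** Leaving at once through [e], or going inside [F] to [f] and leaving there, gives two simple
    walks from [al e] to [t]. They coincide, and as [om e] is off [F] the part inside [F] is
    empty. *)
Lemma beyond_unique F e f t : tconn F -> NF D F e -> NF D F f ->
  beyond D F e t -> beyond D F f t -> e = f.
Proof.
move=> cF [Fe nFe] [Ff nFf] [s [ws [ls /all_inP as_]]] [s' [ws' [ls' /all_inP as']]].
have [p [wp [lp /all_inP ap]]] := cF _ _ Fe Ff.
have [s1 [w1 l1 i1 n1]] := walk_simple _ _ ws.
have [s2 [w2 l2 i2 n2]] := walk_simple _ _ ws'.
have [q [wq lq iq nq]] := walk_simple _ _ wp.
have out1 z : List.In z (om e :: s1) -> ~ F z by case=> [<-//|/i1 zs]; apply: as_; right.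
have out2 z : List.In z (om f :: s2) -> ~ F z by case=> [<-//|/i2 zs]; apply: as'; right.
have inq z : List.In z (al e :: q) -> F z by case=> [<-//|/iq /ap].
have E : om e :: s1 = q ++ om f :: s2.
  apply: (@simple_walk_unique (al e)).
  - by split=> //; exact: adj_edge.
  - apply/walk_cat; split=> //; rewrite lq lp; split=> //; exact: adj_edge.
  - by rewrite last_cat /= l1 l2 ls.
  - by constructor=> // /out1.
  - rewrite -cat_cons; apply: (@List.NoDup_app _ (al e :: q) (om f :: s2)) => // z zq zf; exact: out2 zf (inq z zq).
case: q {wq iq nq} E lq inq => [|a q] /= [E1 E2] lq inq.
  by apply: tedge_inj => //; rewrite -lp -lq.
by exfalso; apply: nFe; rewrite E1; apply: inq; right; left.
Qed.

(* An orientation of the tree which converges to a vertex or to an end. *)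
Definition flow (O : tE D -> Prop) :=
  (forall e, O (trev D e) <-> ~ O e) /\
  (forall e f, al e = al f -> O e -> O f -> e = f).
(** For the flow towards a vertex or an end, this is the vertex of [F] nearest to it. *)
Definition gate (O : tE D -> Prop) (F : set (tV D)) v :=
  F v /\ forall e, al e = v -> O e -> ~ F (om e).

(** On a simple walk from [v] to [w] inside [F] the first edge is not in [O], so its reversal is. As
    at most one edge of [O] leaves each vertex, all later edges are traversed against [O] too; the
    reversal of the last one leaves [w] and stays in [F], a contradiction. *)
Lemma gate_unique O F v w : flow O -> tconn F -> gate O F v -> gate O F w -> v = w.
Proof.
move=> [Orev Ouniq] cF [Fv gv] [Fw gw].
have [s [ws [ls /all_inP as_]]] := cF _ _ Fv Fw.
have [s' [ws' ls' is' nd]] := walk_simple _ _ ws.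
have as' z : List.In z s' -> F z by move/is'/as_.
have : s' = [::].
  move: ws' ls' nd as'; rewrite ls; clear - Orev Ouniq gv gw Fv Fw HT.
  move=> ws' ls' nd as'.
  have hv e : al e = v -> O e -> forall a, List.In a s' -> om e <> a.
    by move=> ev Oe a /as' Fa ea; apply: (gv e ev Oe); rewrite ea.
  move: v Fv {gv} hv ws' ls' nd.
  elim: s' as' => [|a s IH] // as_ u Fu hu /= [[e [eu ea]] ws] ls nd.
  exfalso.
  have Ore : O (trev D e).
    by apply/Orev => Oe; apply: (hu e eu Oe a) => //; left.
  have Fa : F a by apply: as_; left.
  have sn : s = [::].
    apply: (IH _ a) => //.
    - by move=> z zs; apply: as_; right.
    - move=> f fa Of b bs fb.
      have ef : f = trev D e by apply: Ouniq => //; rewrite fa -ea.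
      move: fb; rewrite ef tomega_rev eu => ub; subst b.
      by inversion nd; apply: H1; right.
    - by inversion nd.
  subst s; simpl in ls; subst w.
  by have := gw (trev D e) ea Ore; rewrite tomega_rev eu.
by move=> s'0; rewrite -ls -ls' s'0.
Qed.

End Tree.

(** * Quotients as sets of classes *)

Lemma sval_inj {A : Type} (P : A -> Prop) : injective (@proj1_sig A P).
Proof. by move=> [x px] [y py] /= xy; apply: eq_exist. Qed.

Lemma qtP {A : Type} (r : A -> A -> Prop) (c : qt r) : exists a, c = qcl r a.
Proof.
case: c => C [a Ca]; exists a; rewrite /qcl; subst C; congr exist.
Qed.

Lemma qcl_eq {A : Type} (r : A -> A -> Prop) a b :
  equivalence A r -> qcl r a = qcl r b <-> r a b.
Proof.
move=> [refl trans sym]; split=> [/(congr1 sval)/= E|rab].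
  by rewrite E; exact: refl.
apply: eq_exist => /=; rewrite predeqE => c; split=> H.
  by apply: trans H; exact: sym.
exact: trans H.
Qed.

Lemma qcl_mem {A : Type} (r : A -> A -> Prop) (c : qt r) a :
  equivalence A r -> sval c a <-> c = qcl r a.
Proof.
move=> er; have [b ->] := qtP r c; by rewrite qcl_eq.
Qed.

Lemma crst_equivalence {A : Type} (r : A -> A -> Prop) :
  equivalence A (clos_refl_sym_trans A r).
Proof. by split; [exact: rst_refl|exact: rst_trans|exact: rst_sym]. Qed.

(** * Flows, gates and ends *)

Section Flow.
Context {R : realType} {D : tdata R} (HT : is_tree D).
Local Notation al := (talpha D).
Local Notation om := (tomega D).
Local Notation walk := (is_walk D).

Lemma gate1 (O : tE D -> Prop) v : gate O [set v] v.
Proof. by split=> // e <- _ /esym; exact: (talpha_tomega HT). Qed.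

(** An edge from [om e] back into [F] can only be the reversal of [e], which is not in [O]. *)
Lemma gate_move (O : tE D -> Prop) F e : flow O -> tconn F -> NF D F e -> O e ->
  gate O (F `|` [set om e]) (om e).
Proof.
move=> [Orev Ouniq] cF [Fe nFe] Oe; split; first by right.
move=> f fe Of [Ff|]; last by move=> ff; apply: (talpha_tomega HT f); rewrite fe.
have ef : al e = om f.
  apply: (tconn_edge_unique HT _ _ _ (om e) cF Fe Ff) => //.
  - by apply: adj_sym => //; exact: adj_edge.
  - by apply: adj_sym => //; rewrite -fe; exact: adj_edge.
have : O (trev D f) by rewrite (_ : trev D f = e) //; apply: tedge_inj; rewrite ?tomega_rev.
by move/Orev.
Qed.

Lemma gate_stay (O : tE D -> Prop) F e v : flow O -> tconn F -> NF D F e -> gate O F v ->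
  ~ (v = al e /\ O e) -> gate O (F `|` [set om e]) v.
Proof.
move=> [Orev Ouniq] cF [Fe nFe] [Fv gv] nve; split; first by left.
move=> f fv Of [|ff]; first exact: gv.
have ef : al e = al f.
  apply: (tconn_edge_unique HT _ _ _ (om e) cF Fe) => //; first by rewrite fv.
  - by apply: adj_sym => //; exact: adj_edge.
  - by rewrite -ff; exact: adj_edge.
by apply: nve; rewrite -fv (tedge_inj HT e f).
Qed.

Lemma gate_exists (O : tE D -> Prop) F : flow O -> fsubtree D F -> exists v, gate O F v.
Proof.
move=> fO tF; have [_ [[x Fx] _]] := tF.
apply: (fsubtree_up HT (fun F => exists v, gate O F v) [set x]) => //.
- exact: fsubtree1.
- by move=> _ ->.
- by exists x; exact: gate1.
move=> G e [_ [_ cG]] _ _ NFe [v gv].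
have [[ve Oe]|nve] := EM (v = al e /\ O e).
  by exists (om e); exact: gate_move.
by exists v; exact: gate_stay.
Qed.

(** The flow with sink [t]: every edge is oriented towards [t]. *)
Definition vflow (t : tV D) (e : tE D) :=
  exists s, walk (om e) s /\ last (om e) s = t /\ List.NoDup (al e :: om e :: s).

Lemma vflow_sink t e : vflow t e -> al e <> t.
Proof.
move=> [s [ws [ls nd]]] et.
suff : om e :: s = [::] by [].
apply: (simple_walk_unique HT (al e)) => //=.
- by split=> //; exact: adj_edge.
- by rewrite ls.
- by apply: List.NoDup_cons; [case|exact: List.NoDup_nil].
Qed.

Lemma flow_vflow t : flow (vflow t).
Proof.
have uniq e f : al e = al f -> vflow t e -> vflow t f -> e = f.
  move=> ef [s [ws [ls nd]]] [s' [ws' [ls' nd']]].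
  have [] : om e :: s = om f :: s'.
    apply: (simple_walk_unique HT (al e)) => //.
    - by split=> //; exact: adj_edge.
    - by rewrite ef; split=> //; exact: adj_edge.
    - by rewrite /= ls ls'.
    - by rewrite ef.
  by move=> ? _; apply: tedge_inj.
split=> // e; split.
  move=> [s' [ws' [ls' nd']]] [s [ws [ls nd]]].
  rewrite tomega_rev // in ws' ls' nd'.
  have E : s = al e :: s'.
    apply: (simple_walk_unique HT (om e)) => //.
    - by split=> //; rewrite -(tomega_rev HT); exact: adj_edge.
    - by rewrite ls -ls'.
    - by inversion nd.
  by inversion nd; apply: H1; rewrite E; right; left.
move=> nO; have [s [ws ls]] := tree_connected HT (al e) t.
have [s' [ws' ls' _ nd]] := walk_simple _ s ws.
have [ein|nein] := EM (List.In (om e) (al e :: s')); last first.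
  exists s'; rewrite tomega_rev // ls' ls; split=> //; split=> //.
  exact: List.NoDup_cons.
case: ein => [/(talpha_tomega HT)//|/(@List.in_split _ _ _)[l1 [l2 E]]].
rewrite (_ : (_ ++ _)%list = l1 ++ om e :: l2) // in E.
exfalso; apply: nO; exists l2.
(* The part of the walk up to [om e] and the single edge [e] are simple walks with the same
   endpoints. *)
have E2 : l1 ++ [:: om e] = [:: om e].
  apply: (simple_walk_unique HT (al e)).
  - by move: ws'; rewrite E -cat1s catA => /walk_cat[].
  - by split=> //; exact: adj_edge.
  - by rewrite last_cat.
  - apply: (List.NoDup_app_remove_r (al e :: (l1 ++ [:: om e])) l2).
    suff -> : ((al e :: (l1 ++ [:: om e])) ++ l2)%list = al e :: s' by [].
    by rewrite E; congr cons; exact: (esym (catA l1 [:: om e] l2)).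
  - apply: List.NoDup_cons; last by apply: List.NoDup_cons; [case|exact: List.NoDup_nil].
    by case=> // /esym; exact: (talpha_tomega HT).
have l10 : l1 = [::].
  by move/(congr1 size): E2; rewrite size_cat addn1 => -[/size0nil].
subst l1; rewrite E /= in ws' nd ls'.
by split; [case: ws'|rewrite ls' ls].
Qed.

Lemma ray_eq_equivalence : equivalence (Ray D) (ray_eq D).
Proof.
split.
- by move=> r; exists 0%N, 0%N.
- move=> r1 r2 r3 [i [j H1]] [k [l H2]]; exists (i + k)%N, (l + j)%N => n.
  by rewrite -addnA H1 addnCA H2 addnA.
- by move=> r1 r2 [i [j H]]; exists j, i.
Qed.

Lemma ray_tail (r : Ray D) k :
  exists r', ray_eq D r r' /\ forall n, sval r' n = sval r (k + n)%N.
Proof.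
case: r => r [adjr injr].
have H : is_ray D (fun n => r (k + n)%N).
  split; first by move=> n; rewrite addnS.
  by move=> m n /injr/addnI.
by exists (exist _ _ H); split=> //; exists k, 0%N.
Qed.

Lemma ray_walk (r : nat -> tV D) n : (forall n, adj D (r n) (r n.+1)) -> forall i,
  walk (r i) (map r (iota i.+1 n)) /\ last (r i) (map r (iota i.+1 n)) = r (i + n)%N.
Proof.
move=> adjr; elim: n => [|n IH] i /=; first by rewrite addn0.
by have [w l] := IH i.+1; rewrite l addSnnS.
Qed.

Lemma NoDup_map_iota {T : Type} (r : nat -> T) i n : injective r ->
  List.NoDup (map r (iota i n)).
Proof.
move=> injr; elim: n i => [|n IH] i /=; first exact: List.NoDup_nil.
apply: List.NoDup_cons => // /(@List.in_map_iff _ _ _ _ _)[k [/injr -> ki]].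
have : i \in iota i.+1 n.
  by elim: (iota i.+1 n) ki => //= a s IHs [->|/IHs]; rewrite inE ?eqxx // => ->; rewrite orbT.
by rewrite mem_iota ltnn.
Qed.

Lemma ray_eq_start (r r' : Ray D) : ray_eq D r r' -> sval r 0%N = sval r' 0%N ->
  sval r 1%N = sval r' 1%N.
Proof.
move=> [i [j H]] H0.
(* The segments end one step past [i] and [j], so that they contain the vertex of index 1 even when
   [i] or [j] is 0. *)
have : map (sval r) (iota 1 i.+1) = map (sval r') (iota 1 j.+1).
  case: r r' H H0 => r [ar ir] [r' [ar' ir']] /= H H0.
  have [w l] := @ray_walk r i.+1 ar 0; have [w' l'] := @ray_walk r' j.+1 ar' 0.
  rewrite !add0n in l l'.
  apply: (simple_walk_unique HT (r 0%N)) => //.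
  - by rewrite H0.
  - by rewrite l H0 l' -addn1 H addn1.
  - exact: (@NoDup_map_iota _ r 0 i.+2).
  - by rewrite H0; exact: (@NoDup_map_iota _ r' 0 j.+2).
by case.
Qed.

(** If the first step of the ray goes to [v], the ray is cut there. Otherwise [v] is put in front:
    it does not lie on the ray, since a later visit would be a second simple walk to the neighbour
    [v]. *)
Lemma ray_adj (r : Ray D) v : adj D v (sval r 0%N) -> exists r',
  ray_eq D r r' /\ sval r' 0%N = v /\ (sval r' 1%N = sval r 0%N \/ sval r 1%N = v).
Proof.
move=> av; have [r1v|r1v] := EM (sval r 1%N = v).
  have [r' [rr' r'E]] := ray_tail r 1.
  by exists r'; split=> //; rewrite r'E; split=> //; right.
case: r av r1v => r [ar ir] /= av r1v.
have vr n : r n <> v.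
  case: n => [|[//|n]] rv.
    by case: av => e [e1 e2]; apply: (talpha_tomega HT e); rewrite e1 e2.
  have [w l] := @ray_walk r n.+2 ar 0.
  have E : map r (iota 1 n.+2) = [:: v].
    apply: (simple_walk_unique HT (r 0%N)) => //.
    - by split=> //; exact: adj_sym.
    - by rewrite l.
    - exact: (@NoDup_map_iota _ r 0 n.+3).
    - apply: List.NoDup_cons; last by apply: List.NoDup_cons; [case|exact: List.NoDup_nil].
      by case=> // vr0; case: av => e [e1 e2]; apply: (talpha_tomega HT e); rewrite e1 e2.
  by move/(congr1 size): E; rewrite size_map size_iota.
have H : is_ray D (fun n => if n is m.+1 then r m else v).
  split; first by case.
  by case=> [|m] [|n] // => [/esym/vr//|/vr//|/ir ->].
exists (exist _ _ H); split; first by exists 0%N, 1%N.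
by split=> //; left.
Qed.

(** The analogue of [vflow] for an end: every edge is oriented towards [xi]. *)
Definition eflow (xi : End D) (e : tE D) :=
  exists r, sval xi r /\ sval r 0%N = al e /\ sval r 1%N = om e.

Lemma end_ray_eq (xi : End D) r r' : sval xi r -> sval xi r' <-> ray_eq D r r'.
Proof.
move=> /(qcl_mem _ _ _ ray_eq_equivalence) ->.
by rewrite qcl_mem ?qcl_eq //; exact: ray_eq_equivalence.
Qed.

Lemma end_ray (xi : End D) v : exists r, sval xi r /\ sval r 0%N = v.
Proof.
have [r xir] : exists r, sval xi r.
  have [r ->] := qtP _ xi; exists r; apply/qcl_mem => //; exact: ray_eq_equivalence.
have [s [ws ls]] := tree_connected HT v (sval r 0%N).
elim: s v ws ls => [|a s IH] v /=; first by exists r.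
move=> [va ws] ls; have [r' [xir' r'0]] := IH a ws ls.
have [|r'' [rr'' [r''0 _]]] := ray_adj r' v; first by rewrite r'0.
by exists r''; split=> //; exact/(end_ray_eq _ _ _ xir').
Qed.

Lemma eflow_step xi v : exists e, al e = v /\ eflow xi e.
Proof.
have [r [xir r0]] := end_ray xi v.
have [e [e0 e1]] : adj D (sval r 0%N) (sval r 1%N) by case: (r) => /= ? [].
by exists e; split; [rewrite e0|exists r].
Qed.

Lemma flow_eflow xi : flow (eflow xi).
Proof.
have uniq e f : al e = al f -> eflow xi e -> eflow xi f -> e = f.
  move=> ef [r [xir [r0 r1]]] [r' [xir' [r'0 r'1]]]; apply: tedge_inj => //.
  rewrite -r1 -r'1; apply: ray_eq_start; last by rewrite r0 r'0.
  exact/(end_ray_eq _ _ _ xir).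
split=> // e; split.
  move=> Ore [r [xir [r0 r1]]].
  have [r' [rr' r'E]] := ray_tail r 1.
  have [f [f0 f1]] : adj D (sval r 1%N) (sval r 2%N) by case: (r) => /= ? [].
  have ef : trev D e = f.
    apply: uniq => //; first by rewrite f0 r1.
    exists r'; rewrite !r'E f0 f1; split=> //; exact/(end_ray_eq _ _ _ xir).
  have : sval r 0%N = sval r 2%N by rewrite -f1 -ef tomega_rev.
  by case: (r) => /= ? [_ inj] /inj.
move=> nO; have [r [xir r0]] := end_ray xi (om e).
have [|r' [rr' [r'0 r'1]]] := ray_adj r (al e); first by rewrite r0; exact: adj_edge.
case: r'1 => [r'1|r1].
  exfalso; apply: nO; exists r'; rewrite r'0 r'1 r0; split=> //.
  exact/(end_ray_eq _ _ _ xir).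
by exists r; rewrite tomega_rev // r0 r1.
Qed.

(** Following [O] from any vertex gives a ray. It never returns: the vertices of a closed trajectory
    would form a finite subtree in which an edge of [O] stays at every vertex, so that it has no
    gate. For an edge of [O], the ray from its terminal vertex is a tail of the ray from its initial
    vertex; by connectedness all these rays define the same end. *)
Lemma flow_end (O : tE D -> Prop) : flow O -> (forall v, exists e, al e = v /\ O e) ->
  exists xi : End D, forall e, eflow xi e <-> O e.
Proof.
move=> fO /choice[nxt nxtP].
pose tr v n := iter n (fun u => om (nxt u)) v.
have adjt v n : adj D (tr v n) (tr v n.+1).
  by rewrite /tr iterS; exists (nxt (iter n (fun u => om (nxt u)) v)); case: (nxtP (iter n (fun u => om (nxt u)) v)).
have trS v m : tr v m.+1 = om (nxt (tr v m)) by [].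
have nocyc v m : tr v m.+1 <> v.
  move=> cyc.
  have [w l] := @ray_walk (tr v) m.+1 (adjt v) 0.
  have inF k : (k <= m.+1)%N -> List.In (tr v k) (v :: map (tr v) (iota 1 m.+1)).
    move=> km; apply: (@List.in_map _ _ (tr v) (iota 0 m.+2)).
    have : k \in iota 0 m.+2 by rewrite mem_iota.
    by elim: (iota 0 m.+2) => //= a s IHs; rewrite inE => /orP[/eqP ->|/IHs]; [left|right].
  have Fin u : List.In u (v :: map (tr v) (iota 1 m.+1)) -> exists2 k, (k <= m)%N & u = tr v k.
    move=> /(@List.in_map_iff _ _ (tr v) (iota 0 m.+2) _)[k [<- ki]].
    have : k \in iota 0 m.+2.
      by elim: (iota 0 m.+2) ki => //= a s IHs [->|/IHs]; rewrite inE ?eqxx // => ->; rewrite orbT.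
    rewrite mem_iota add0n => /andP[_]; rewrite ltnS leq_eqVlt => /orP[/eqP ->|]; last by exists k.
    by exists 0%N => //; rewrite cyc.
  have [|u [Fu gu]] := gate_exists O [set x | List.In x (v :: map (tr v) (iota 1 m.+1))] fO.
    split; first exact: finite_set_In.
    by split; [exists v; left|exact: walk_conn].
  have [k km uk] := Fin _ Fu.
  have [nu Onu] := nxtP u.
  by apply: (gu (nxt u)) => //; rewrite uk -trS; exact: inF.
have trD v i k : tr v (i + k)%N = tr (tr v i) k by rewrite /tr addnC iterD.
have injt v : injective (tr v).
  suff H i k : tr v i <> tr v (i + k.+1)%N.
    move=> i j ij; case: (ltngtP i j) => // lij; exfalso.
      by apply: (H i (j - i).-1); rewrite prednK ?subn_gt0 // subnKC // ltnW.
    by apply: (H j (i - j).-1); rewrite prednK ?subn_gt0 // subnKC // ltnW.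
  by rewrite trD => /esym; exact: nocyc.
pose ray v : Ray D := exist _ (tr v) (conj (adjt v) (injt v)).
have rayE v : ray_eq D (ray (om (nxt v))) (ray v).
  by exists 0%N, 1%N => n; exact: (esym (trD v 1%N n)).
have ray_edge e : O e -> ray_eq D (ray (om e)) (ray (al e)).
  move=> Oe; suff -> : e = nxt (al e).
    by have [-> _] := nxtP (al e); exact: rayE.
  by case: fO => _; apply=> //; case: (nxtP (al e)).
have [refl trans sym] := ray_eq_equivalence.
have ray_all u v : ray_eq D (ray u) (ray v).
  have [s [ws <-]] := tree_connected HT u v.
  elim: s u ws => [|a s IH] u //= [[e [<- <-]] ws].
  apply: (trans _ (ray (om e))); last exact: IH.
  have [Oe|/(proj1 fO e)/ray_edge] := EM (O e); first by apply: sym; exact: ray_edge.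
  by rewrite tomega_rev.
have [_ [[v0] _]] := HT.
pose xi : End D := qcl (ray_eq D) (ray v0).
have Oxi v : eflow xi (nxt v).
  exists (ray v); split; first exact: ray_all.
  by have [-> _] := nxtP v.
exists xi => e; split=> Oe.
  have -> : e = nxt (al e); last by case: (nxtP (al e)).
  by apply: (proj2 (flow_eflow xi)) => //; case: (nxtP (al e)).
have -> : e = nxt (al e); last exact: Oxi.
by apply: (proj2 fO) => //; case: (nxtP (al e)).
Qed.

(** One inclusion suffices because both flows have exactly one edge out of every vertex; the rays of
    the two ends from a common vertex are then equal. *)
Lemma eflow_inj xi xi' : (forall e, eflow xi e -> eflow xi' e) -> xi = xi'.
Proof.
move=> H; have [_ [[v0] _]] := HT.
have [r [xir r0]] := end_ray xi v0.
have [r' [xir' r'0]] := end_ray xi' v0.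
have rr' n : sval r n = sval r' n.
  elim: n => [|n IH]; first by rewrite r0 r'0.
  have [e [e0 e1]] : adj D (sval r n) (sval r n.+1) by case: (r) => /= ? [].
  have [f [f0 f1]] : adj D (sval r' n) (sval r' n.+1) by case: (r') => /= ? [].
  suff ef : e = f by rewrite -e1 -f1 ef.
  have [q [rq qE]] := ray_tail r n; have [q' [rq' qE']] := ray_tail r' n.
  apply: (proj2 (flow_eflow xi')); first by rewrite e0 f0.
    apply: H; exists q; rewrite !qE addn0 addn1; split=> //; exact/(end_ray_eq _ _ _ xir).
  by exists q'; rewrite !qE' addn0 addn1; split=> //; exact/(end_ray_eq _ _ _ xir').
have {}rr' : r = r' by apply: sval_inj; rewrite funeqE.
move: xir xir'; rewrite -rr'.
by rewrite !(qcl_mem _ _ _ ray_eq_equivalence) => -> ->.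
Qed.

End Flow.

(* Makes the standing assumptions implicit arguments of the lemmas. *)
Existing Class tree_system.
Existing Class ext_family.
Existing Class fine_family.

(** No decidable equality on [A] is at hand; the loop [a = a] induced on the first component is
    trivial by proof irrelevance. *)
Lemma existT_inj {A : Type} {P : A -> Type} a (x y : P a) :
  existT P a x = existT P a y -> x = y.
Proof.
move=> E; suff H p q (pq : p = q) :
    eq_rect (projT1 p) P (projT2 p) (projT1 q) (congr1 (@projT1 A P) pq) = projT2 q.
  by have := H _ _ E; rewrite (Prop_irrelevance (congr1 _ E) (erefl a : projT1 (existT P a x) = projT1 (existT P a y))).
by case: q / pq.
Qed.

Lemma inl_eq {A B : Type} (x y : A) : inl B x = inl B y -> x = y.
Proof. by case. Qed.

Lemma inr_eq {A B : Type} (x y : B) : inr A x = inr A y -> x = y.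
Proof. by case. Qed.

(** * Points of the extended spaces *)

Section Points.
Context {R : realType} {Th : theta R} {HT : tree_system Th}.
Local Notation D := (thdata Th).
Local Notation al := (alpha Th).
Local Notation om := (omega Th).
Local Notation rv := (Defs.rev Th).

Lemma tree_of : is_tree D. Proof. by case: HT. Qed.

Lemma edge_revK e : rv (rv e) = e. Proof. exact: (trevK tree_of). Qed.
Lemma omega_rev e : om (rv e) = al e. Proof. exact: (tomega_rev tree_of). Qed.
Lemma alpha_omega e : al e <> om e. Proof. exact: (talpha_tomega tree_of). Qed.

Definition gl (e : Edge Th) (u v : Pt D) := exists x, Sig Th e x /\
  u = existT (tK D) (al e) x /\ v = existT (tK D) (al (rv e)) (phi Th e x).

Definition inSig (e : Edge Th) (u : Pt D) := exists x, Sig Th e x /\ u = existT (tK D) (al e) x.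

Lemma inSig_inj e f u : inSig e u -> inSig f u -> e = f.
Proof.
by case: HT => _ [_ [_ [_ [_ [H _]]]]] [x [sx ->]] [y [sy]]; exact: H.
Qed.

Lemma inSig_projT1 e u : inSig e u -> projT1 u = al e.
Proof. by case=> x [_ ->]. Qed.

Lemma phi_Sig e x : Sig Th e x -> Sig Th (rv e) (phi Th e x).
Proof. by case: HT => _ [_ [_ [/(_ e)[_ [H _]] _]]]; exact: H. Qed.

Lemma gl_sym e u v : gl e u v -> gl (rv e) v u.
Proof.
move=> [x [sx [-> ->]]]; exists (phi Th e x); split; first exact: phi_Sig.
by split=> //; case: HT => _ [_ [_ [_ [/(_ e x sx)-> _]]]].
Qed.

Lemma gl_inSig e u v : gl e u v -> inSig e u.
Proof. by case=> x [? [? _]]; exists x. Qed.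

Lemma gl_inSigr e u v : gl e u v -> inSig (rv e) v.
Proof. by move/gl_sym/gl_inSig. Qed.

Lemma gl_fun e f u v w : gl e u v -> gl f u w -> e = f /\ v = w.
Proof.
move=> h1 h2; have ef := inSig_inj _ _ _ (gl_inSig _ _ _ h1) (gl_inSig _ _ _ h2).
subst f; split=> //; case: h1 h2 => x [sx [-> ->]] [y [sy [xy ->]]].
by rewrite (existT_inj _ _ _ xy).
Qed.

(** As the peripheral subspaces of a constituent space are disjoint, a point is glued along at most
    one edge. Classes have at most two points, and chains of gluings collapse. *)
Lemma equivFE F u v :
  equivF D F u v <-> u = v \/ exists e, F (al e) /\ F (om e) /\ gl e u v.
Proof.
split; last first.
  case=> [->|[e [Fa [Fo [x [sx [-> ->]]]]]]]; first exact: rst_refl.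
  by apply: rst_step; exists e, x, (phi Th e x).
elim=> {u v} [u v|u|u v _|u v w _ H1 _ H2].
- by case=> e [x [y [Fa [Fo [[sx ->] [-> ->]]]]]]; right; exists e; split=> //; split=> //; exists x.
- by left.
- case=> [->|[e [Fa [Fo g]]]]; first by left.
  by right; exists (rv e); rewrite omega_rev; split=> //; split=> //; exact: gl_sym.
- case: H1 => [->//|[e [Fa [Fo g]]]]; case: H2 => [<-|[f [Fa' [Fo' g']]]].
    by right; exists e.
  by left; have [_ ->] := gl_fun _ _ _ _ _ (gl_sym _ _ _ g) g'.
Qed.

Section Ext.
Context {X : extsp Th} {delta : forall e : Edge Th, hatK Th X (omega Th e) -> Delta Th X e}.
Context {HE : ext_family Th X delta}.
Local Notation Sper := (Sper Th X).
Local Notation hatK := (hatK Th X).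
Local Notation HP := (HP Th X).

Lemma ext_of : ext_ok Th X. Proof. by case: HE. Qed.

Lemma varphi_Sig e s : Sper e s -> Sig Th e (varphi Th X e s).
Proof. by case: (ext_of e) => _ [_ [_ [_ [H _]]]]; exact: H. Qed.

Lemma varphi_inj e s s' : Sper e s -> Sper e s' ->
  varphi Th X e s = varphi Th X e s' -> s = s'.
Proof.
case: (ext_of e) => _ [_ [_ [_ [_ [g [_ [_ gK]]]]]]] hs hs' E.
by rewrite -(gK _ hs) -(gK _ hs') E.
Qed.

Lemma varphi_surj e x : Sig Th e x -> exists s, Sper e s /\ varphi Th X e s = x.
Proof.
by case: (ext_of e) => _ [_ [_ [_ [_ [g [_ [gK _]]]]]]] /gK[? ?]; exists (g x).
Qed.

(* [HP] is the disjoint union of the extended spaces; [KP] and [DP] embed into it the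
   disjoint unions of the [K_t] and of the [Delta_e]. *)
Definition KP (u : Pt D) : HP := existT hatK (projT1 u) (kpt Th X _ (projT2 u)).
Definition DP (e : Edge Th) (s : Delta Th X e) : HP := existT hatK (al e) (dpt' Th X e s).
Definition vphi (e : Edge Th) (s : Delta Th X e) : Pt D :=
  existT (tK D) (al e) (varphi Th X e s).

(* Invariant that separates the points of the extended spaces: a point of [S_e] is
   represented by its image in [Sigma_e], the points off the [K_t] by themselves. *)
Definition core t (p : Pt (star Th X t)) : Pt D + {e & Delta Th X e} :=
  match p with
  | existT None y => inl (existT (tK D) t y)
  | existT (Some e) s =>
      match pselect (Sper (sval e) s) with
      | left _ => inl (vphi (sval e) s)
      | right _ => inr (existT (Delta Th X) (sval e) s)
      end
  end.

Lemma core_Sper t (e : Nt Th t) s : Sper (sval e) s ->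
  core t (existT (tK (star Th X t)) (Some e) s) = inl (vphi (sval e) s).
Proof. by rewrite /core; case: pselect. Qed.

Lemma core_off t (e : Nt Th t) s : ~ Sper (sval e) s ->
  core t (existT (tK (star Th X t)) (Some e) s) = inr (existT (Delta Th X) (sval e) s).
Proof. by rewrite /core; case: pselect. Qed.

Lemma core_equiv t (p q : Pt (star Th X t)) :
  equivF (star Th X t) setT p q <-> core t p = core t q.
Proof.
have KD (e : Nt Th t) s y : Sper (sval e) s -> vphi (sval e) s = existT (tK D) t y ->
    equivF (star Th X t) setT (existT (tK (star Th X t)) (Some e) s)
      (existT (tK (star Th X t)) None y).
  by move=> hs E; apply: rst_step; exists (false, e), s, y.
split.
  elim=> {p q} [p q|p|p q _ ->|p q r _ -> _ ->] //.
  move=> [[b e] [x [y H]]]; case: b x y H => x y [_ [_ [[hy E] [-> ->]]]].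
    by rewrite core_Sper //; congr inl.
  by rewrite core_Sper //; congr inl.
case: p => [[e|] s]; case: q => [[f|] s'].
- have [hs|hs] := pselect (Sper (sval e) s); have [hs'|hs'] := pselect (Sper (sval f) s').
  + rewrite !core_Sper // => E0; have {E0} E := inl_eq _ _ E0.
    case: e s hs E => e0 et; subst t => s hs E.
    have H1 := KD _ _ (varphi Th X e0 s) hs erefl.
    have H2 := KD _ _ (varphi Th X e0 s) hs' (esym E).
    by apply: rst_trans H1 _; exact: rst_sym.
  + by rewrite core_Sper // core_off.
  + by rewrite core_off // core_Sper.
  + rewrite !core_off // => E0; have {E0} E := inr_eq _ _ E0.
    have ef := congr1 (@projT1 _ _) E; move: ef E.
    case: e s hs => e0 et s hs; case: f s' hs' => f0 ft s' hs' /= ef.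
    move=> E; subst f0; have {}E := existT_inj _ _ _ E; subst s'.
    by rewrite (Prop_irrelevance et ft); exact: rst_refl.
- have [hs|hs] := pselect (Sper (sval e) s); last by rewrite core_off.
  by rewrite core_Sper // => E0; have {E0} E := inl_eq _ _ E0; exact: KD.
- have [hs|hs] := pselect (Sper (sval f) s'); last by rewrite core_off.
  by rewrite core_Sper // => E0; have {E0} E := inl_eq _ _ E0; apply: rst_sym; exact: KD.
- by move=> E0; have {E0} E := inl_eq _ _ E0; rewrite (existT_inj _ _ _ E); exact: rst_refl.
Qed.

(** Every edge of the star has the centre [None] as one of its ends, so a ray would visit the centre
    twice. *)
Lemma star_no_end t : End (star Th X t) -> False.
Proof.
move=> xi; have [[r [ar ir]] _] := qtP _ xi.
have H n : r n = None \/ r n.+1 = None.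
  by have [[[] e] [/= <- <-]] := ar n; [left|right].
have step n : r n = None -> r n.+1 <> None.
  by move=> H0 H1; have := ir n n.+1; rewrite H0 H1 => /(_ erefl)/n_Sn.
have [n rn] : exists n, r n = None by have [] := H 0%N; [exists 0%N|exists 1%N].
have [/(step n rn)//|rn2] := H n.+1.
by have := ir n n.+2; rewrite rn rn2 => /(_ erefl) /esym/eqP; rewrite -addn2 -{2}(addn0 n) eqn_add2l.
Qed.

Lemma hatK_case t (z : hatK t) : (exists y, z = kpt Th X t y) \/
  exists (e : Nt Th t) s, z = dpt Th X t e s.
Proof.
case: z => [c|/star_no_end//]; have [[[e|] s] ->] := qtP _ c.
  by right; exists e, s.
by left; exists s.
Qed.

Lemma DPE t (e : Nt Th t) s : existT hatK t (dpt Th X t e s) = DP (sval e) s.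
Proof. by case: e s => e et s; subst t. Qed.

Lemma HP_case (p : HP) : (exists u, p = KP u) \/ exists e s, p = DP e s.
Proof.
case: p => t z; have [[y ->]|[e [s ->]]] := hatK_case t z.
  by left; exists (existT (tK D) t y).
by right; exists (sval e), s; rewrite DPE.
Qed.

Lemma hat_inj t (p q : Pt (star Th X t)) :
  (inl (qcl (equivF (star Th X t) setT) p) : hatK t) = inl (qcl (equivF (star Th X t) setT) q) ->
  core t p = core t q.
Proof.
move=> E; apply/core_equiv/(qcl_eq _ _ _ (crst_equivalence _)).
exact: (inl_eq _ _ E).
Qed.

Lemma hat_eq t (p q : Pt (star Th X t)) : core t p = core t q ->
  (inl (qcl (equivF (star Th X t) setT) p) : hatK t) = inl (qcl (equivF (star Th X t) setT) q).
Proof. by move=> H; congr inl; apply/qcl_eq; [exact: crst_equivalence|exact/core_equiv]. Qed.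

Lemma KP_inj u v : KP u = KP v -> u = v.
Proof.
case: u v => [t y] [t' y'] E.
have /= tt := congr1 (@projT1 _ _) E; subst t'.
by have E1 := hat_inj _ _ _ (existT_inj _ _ _ E); exact: (inl_eq _ _ E1).
Qed.

Lemma KP_DP u e s : KP u = DP e s <-> Sper e s /\ u = vphi e s.
Proof.
split.
  case: u => [t y] E.
  have /= tt := congr1 (@projT1 _ _) E; subst t.
  have := hat_inj _ _ _ (existT_inj _ _ _ E).
  have [hs|hs] := pselect (Sper e s).
    by rewrite (core_Sper (al e) (exist _ e erefl)) // => E1; split=> //; exact: (inl_eq _ _ E1).
  by rewrite (core_off (al e) (exist _ e erefl)).
move=> [hs ->]; congr existT; apply: hat_eq.
by rewrite (core_Sper (al e) (exist _ e erefl)).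
Qed.

Lemma DP_inj e s f s' : DP e s = DP f s' -> existT (Delta Th X) e s = existT (Delta Th X) f s'.
Proof.
move=> E; have /= ef := congr1 (@projT1 _ _) E.
have := E; rewrite /DP /dpt' => E'.
have {}E' : existT hatK (al f) (dpt Th X (al f) (exist _ e ef) s) =
   existT hatK (al f) (dpt Th X (al f) (exist _ f erefl) s').
  by rewrite DPE.
have := hat_inj _ _ _ (existT_inj _ _ _ E').
have [hs|hs] := pselect (Sper e s); have [hs'|hs'] := pselect (Sper f s'); last first.
- rewrite (core_off _ (exist _ e ef)) // (core_off _ (exist _ f erefl)) // => E1; exact: (inr_eq _ _ E1).
- by rewrite (core_off _ (exist _ e ef)) // (core_Sper _ (exist _ f erefl)).
- by rewrite (core_Sper _ (exist _ e ef)) // (core_off _ (exist _ f erefl)).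
rewrite (core_Sper _ (exist _ e ef)) // (core_Sper _ (exist _ f erefl)) //=.
move=> E0; have {E0} vv := inl_eq _ _ E0; have ee : e = f.
  apply: (inSig_inj _ _ (vphi e s)); first by exists (varphi Th X e s); split=> //; exact: varphi_Sig.
  by rewrite vv; exists (varphi Th X f s'); split=> //; exact: varphi_Sig.
subst f; have {}vv := existT_inj _ _ _ vv.
by rewrite (varphi_inj _ _ _ hs hs' vv).
Qed.

Lemma DP_eq e s s' : DP e s = DP e s' -> s = s'.
Proof. by move=> E; exact: (existT_inj _ _ _ (DP_inj _ _ _ _ E)). Qed.

Lemma inSig_vphi e s : Sper e s -> inSig e (vphi e s).
Proof. by move=> hs; exists (varphi Th X e s); split=> //; exact: varphi_Sig. Qed.

Lemma KP_DP_inSig u e s : KP u = DP e s -> inSig e u.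
Proof. by move/KP_DP => [hs ->]; exact: inSig_vphi. Qed.

Lemma inSig_KP_DP e u : inSig e u -> exists s, Sper e s /\ KP u = DP e s.
Proof.
move=> [x [sx ->]]; have [s [hs vx]] := varphi_surj e x sx.
by exists s; split=> //; apply/KP_DP; split=> //; rewrite /vphi vx.
Qed.

(* The points of [hat K_t] that survive in [hat K_F]. *)
Definition inY (F : set (Vert Th)) (p : HP) := forall e s, F (om e) -> p = DP e s -> Sper e s.

Lemma YsetE F t z : Yset Th X F t z <-> inY F (existT hatK t z).
Proof.
split=> [H e s Fo E|H [e [s [Fo [ns E]]]]].
  have /= tt := congr1 (@projT1 _ _) E; subst t.
  apply: contrapT => ns; apply: H; exists (exist (fun f => al f = al e) e erefl), s; split=> //; split=> //.
  exact: existT_inj E.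
by apply: ns; apply: (H (sval e) s Fo); rewrite E DPE.
Qed.

Lemma inY_KP F u : inY F (KP u).
Proof. by move=> e s _ /KP_DP[]. Qed.

Lemma inY_DP F e s : ~ F (om e) -> inY F (DP e s).
Proof.
move=> Fe f s' Ff E; exfalso; apply: Fe.
by have /= -> := congr1 (@projT1 _ _) (DP_inj _ _ _ _ E).
Qed.

Lemma hatKeE e z : hatKe Th X e z <->
  forall s, existT hatK (om e) z = DP (rv e) s -> Sper (rv e) s.
Proof.
split=> [H s E|H [s [ns E]]].
  by apply: contrapT => ns; apply: H; exists s; split=> //; exact: existT_inj E.
by apply: ns; apply: H; rewrite E.
Qed.

(* Equality in [hat K_F], in terms of representatives; it does not depend on [F]. *)
Definition hq (p q : HP) := p = q \/ exists e u v, gl e u v /\ p = KP u /\ q = KP v.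

Lemma hq_refl p : hq p p. Proof. by left. Qed.

Lemma hq_sym p q : hq p q -> hq q p.
Proof.
by case=> [->|[e [u [v [/gl_sym g [-> ->]]]]]]; [left|right; exists (rv e), v, u].
Qed.

Lemma hq_trans p q r : hq p q -> hq q r -> hq p r.
Proof.
case=> [->//|[e [u [v [g [-> ->]]]]]] [<-|[f [u' [v' [g' [uv ->]]]]]].
  by right; exists e, u, v.
move/KP_inj: uv => uv; subst u'; left; congr KP.
by have [_ ->] := gl_fun _ _ _ _ _ (gl_sym _ _ _ g) g'.
Qed.

Lemma hq_projT1 p q : hq p q -> projT1 p = projT1 q -> p = q.
Proof.
case=> // -[e [u [v [[x [_ [-> ->]]] [-> ->]]]]] /= ao.
by exfalso; apply: (alpha_omega e).
Qed.

(** A point of [Delta_e] can only be glued along [e], hence to a point over [om e], which is off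
    [F]. *)
Lemma DP_hq F e s q : NF D F e -> hq (DP e s) q -> F (projT1 q) -> q = DP e s.
Proof.
move=> [Fe Fo] [->//|[f [u [v [g [E ->]]]]]] Fq.
exfalso; apply: Fo.
have E2 : e = f.
  by apply: (inSig_inj _ _ u); [exact: (KP_DP_inSig _ _ s)|exact: gl_inSig g].
subst f; move: Fq => /=; case: g => x [_ [_ ->]] //.
Qed.

(* The bonding map for the removal of the vertex [omega e], in terms of representatives. *)
Definition foldp (e : Edge Th) (p : HP) : HP :=
  match pselect (projT1 p = om e) with
  | left h => DP e (delta e (eq_rect _ hatK (projT2 p) _ h))
  | right _ => p
  end.

Lemma foldp_id e p : projT1 p <> om e -> foldp e p = p.
Proof. by rewrite /foldp; case: pselect. Qed.

Lemma foldp_om e z : foldp e (existT hatK (om e) z) = DP e (delta e z).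
Proof.
rewrite /foldp; case: pselect => //= h.
by rewrite (Prop_irrelevance h erefl).
Qed.

Lemma foldp_gl e u v : gl e u v -> foldp e (KP v) = KP u.
Proof.
move=> /gl_sym[x [sx [-> ->]]]; apply: (etrans (foldp_om _ _)).
case: HE => _ /(_ e)[_ /(_ x sx)[hs E]].
by apply/esym; apply/KP_DP; split.
Qed.

Lemma foldp_projT1 e p : projT1 p = om e -> exists s, foldp e p = DP e s.
Proof. by case: p => t z /= h; subst t; rewrite foldp_om; exists (delta e z). Qed.


(** * Threads *)

Local Notation FT := (FT Th).
Local Notation Thr := (Thr Th X delta).

Lemma hq_inY F (p q : HP) : hq p q -> inY F p -> inY F q.
Proof.
case=> [->//|[e [u [v [_ [_ ->]]]]]] _; exact: inY_KP.
Qed.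

Lemma piece_inY F (P : Piece Th X F) : inY F (sval P).
Proof. by case: P => -[t z] /= [_ /YsetE]. Qed.

Lemma inY_piece F (p : HP) : F (projT1 p) -> inY F p -> exists P : Piece Th X F, sval P = p.
Proof. by case: p => t z /= Ft /YsetE Y; exists (exist _ (existT hatK t z) (conj Ft Y)). Qed.

Lemma hclassE F (P Q : Piece Th X F) :
  hclass Th X F P = hclass Th X F Q <-> hq (sval P) (sval Q).
Proof.
rewrite /hclass qcl_eq; last exact: crst_equivalence.
split.
  elim=> {P Q} [P Q|P|P Q _|P Q S _ H1 _].
  - move=> [e [x [_ [_ [sx [-> ->]]]]]]; right.
    by exists e, (existT (tK D) (al e) x), (existT (tK D) (al (rv e)) (phi Th e x)); split=> //; exists x.
  - exact: hq_refl.
  - exact: hq_sym.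
  - exact: hq_trans.
case=> [/sval_inj ->|[e [u [v [[x [sx [-> ->]]] [EP EQ]]]]]]; first exact: rst_refl.
apply: rst_step; exists e, x; split; last split=> //.
  by have := proj1 (svalP P); rewrite EP.
by have := proj1 (svalP Q); rewrite EQ.
Qed.

(* [p] represents the coordinate of the thread [x] at [F]. *)
Definition thpt (x : Thr) (F : FT) (p : HP) :=
  exists P : Piece Th X (sval F), sval P = p /\ sval x F = hclass Th X (sval F) P.

Lemma thpt_exists x F : exists p, thpt x F p.
Proof. by have [P xP] := qtP _ (sval x F); exists (sval P), P. Qed.

Lemma thpt_in x F p : thpt x F p -> sval F (projT1 p).
Proof. by case=> P [<- _]; case: (svalP P). Qed.

Lemma thpt_inY x F p : thpt x F p -> inY (sval F) p.
Proof. by case=> P [<- _]; exact: piece_inY. Qed.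

Lemma thpt_hq x F p q : thpt x F p -> thpt x F q -> hq p q.
Proof. by move=> [P [<- xP]] [Q [<- xQ]]; apply/hclassE; rewrite -xP. Qed.

Lemma thpt_trans x F p q : thpt x F p -> hq p q -> sval F (projT1 q) -> thpt x F q.
Proof.
move=> xp pq Fq; have [P [EP xP]] := xp.
have [Q EQ] := inY_piece _ _ Fq (hq_inY _ _ _ pq (thpt_inY _ _ _ xp)).
by exists Q; split=> //; rewrite xP; apply/hclassE; rewrite EP EQ.
Qed.

Lemma thr_ext (x y : Thr) : (forall F, exists p, thpt x F p /\ thpt y F p) -> x = y.
Proof.
move=> H; apply: sval_inj; apply: functional_extensionality_dep => F.
have [p [[P [EP ->]] [Q [EQ ->]]]] := H F.
by apply/hclassE; rewrite EP EQ; exact: hq_refl.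
Qed.

Lemma foldp_in (F : set (Vert Th)) e p : NF D F e -> (F `|` [set om e]) (projT1 p) ->
  F (projT1 (foldp e p)).
Proof.
move=> [Fe _] Fp; have [pe|pe] := EM (projT1 p = om e).
  by have [s ->] := foldp_projT1 _ _ pe.
by rewrite foldp_id //; case: Fp.
Qed.

Lemma foldp_inY (F : set (Vert Th)) e p : NF D F e -> inY (F `|` [set om e]) p ->
  inY F (foldp e p).
Proof.
move=> [_ Fe] Yp; have [pe|pe] := EM (projT1 p = om e).
  by have [s ->] := foldp_projT1 _ _ pe; exact: inY_DP.
by rewrite foldp_id // => f s Ff; apply: Yp; left.
Qed.

(** Only an identification with a point over [om e] is affected. It is along [e], the one edge
    joining [om e] to [F], where the boundary condition on [delta e] applies. *)
Lemma foldp_hq (F : set (Vert Th)) e p q : tconn (D := D) F -> NF D F e ->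
  (F `|` [set om e]) (projT1 p) -> (F `|` [set om e]) (projT1 q) ->
  hq p q -> hq (foldp e p) (foldp e q).
Proof.
suff key u v f : tconn (D := D) F -> NF D F e -> gl f u v -> (F `|` [set om e]) (projT1 u) ->
    projT1 u <> om e -> projT1 v = om e -> foldp e (KP v) = KP u.
  move=> cF NFe Fp Fq [->|[f [u [v [g [pu qv]]]]]]; first exact: hq_refl.
  subst p q.
  have [uo|uo] := EM (projT1 u = om e); have [vo|vo] := EM (projT1 v = om e).
  - exfalso; case: g uo vo => y [_ [-> ->]] /= uo vo.
    by apply: (alpha_omega f); rewrite uo; exact: esym vo.
  - left; rewrite (foldp_id _ (KP v)) //.
    exact: (key _ _ _ cF NFe (gl_sym _ _ _ g)).
  - by left; rewrite (foldp_id _ (KP u)) // (key _ _ _ cF NFe g).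
  - by rewrite !foldp_id //; right; exists f, u, v.
move=> cF [Fe nFe] g [Fu|//] uo vo.
suff fe : f = e by subst f; exact: foldp_gl.
have [y [_ [Eu Ev]]] := g.
rewrite Ev /= in vo; rewrite Eu /= in Fu.
apply: (tedge_inj tree_of) => //.
apply: (tconn_edge_unique tree_of _ _ _ (om e) cF Fu Fe) => //.
- by exists (trev D f); split=> //; rewrite (tomega_rev tree_of).
- by exists e.
Qed.

(** Compatibility provides a suitable pair of representatives; here it becomes usable for every
    representative. *)
Lemma thpt_fold x (F1 F2 : FT) e p : NF D (sval F1) e ->
  sval F2 = sval F1 `|` [set om e] -> thpt x F2 p -> thpt x F1 (foldp e p).
Proof.
move=> NFe E xp; have [Fe nFe] := NFe.
have [P2 [P1 [x2 [x1 H]]]] := svalP x F1 F2 e Fe nFe E.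
have xP2 : thpt x F2 (sval P2) by exists P2.
have fP2 : sval P1 = foldp e (sval P2).
  case: H => [[F1P ->]|[z [_ [-> ->]]]].
    by rewrite foldp_id // => Ee; apply: nFe; move: F1P; rewrite Ee.
  by rewrite foldp_om.
have xP1 : thpt x F1 (foldp e (sval P2)) by exists P1.
have [_ [_ cF1]] := svalP F1.
have pF := thpt_in _ _ _ xp; have P2F := thpt_in _ _ _ xP2.
rewrite E in pF; have {}P2F : (sval F1 `|` [set om e]) (projT1 (sval P2)) by rewrite -E.
apply: (thpt_trans _ _ _ _ xP1); last exact: foldp_in.
by apply: (foldp_hq (sval F1)) => //; exact: (thpt_hq _ _ _ _ xP2 xp).
Qed.

Lemma thpt_sub x (F1 F2 : FT) p : sval F1 `<=` sval F2 -> thpt x F2 p ->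
  sval F1 (projT1 p) -> thpt x F1 p.
Proof.
case: F1 F2 => [F1 t1] [F2 t2] /= F12 xp F1p.
suff : forall tF, thpt x (exist _ F1 tF) p by exact.
apply: (fsubtree_down tree_of (fun F => forall tF, thpt x (exist _ F tF) p) F1 F2) => //.
  by move=> tF; rewrite (Prop_irrelevance tF t2).
move=> F e tF0 F1F _ NFe IH tF.
have tF' := fsubtree_add tree_of F e tF (proj1 NFe).
have := thpt_fold _ (exist _ F tF) (exist _ _ tF') e p NFe erefl (IH tF').
rewrite foldp_id // => Ee; case: NFe => _; apply.
by move: (F1F _ F1p); rewrite Ee.
Qed.

(** While vertices are removed, the representative stays beyond [e] until [om e] is removed while
    carrying it. It is then folded into [Delta_e], and there it remains, because [al e] lies in
    [F1]. *)
Lemma thpt_beyond x (F1 F2 : FT) p e : sval F1 `<=` sval F2 -> thpt x F2 p ->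
  NF D (sval F1) e -> beyond D (sval F1) e (projT1 p) -> exists s, thpt x F1 (DP e s).
Proof.
case: F1 F2 => [F1 t1] [F2 t2] /= F12 xp NFe bp.
have bn v : beyond D F1 e v -> ~ F1 v.
  by move=> [s [_ [<- /all_inP H]]]; apply: H; exact: In_last.
pose P F := forall tF : fsubtree D F, exists q, thpt x (exist _ F tF) q /\
  (beyond D F1 e (projT1 q) \/ exists s, q = DP e s).
suff H : P F1.
  have [q [xq [/bn []|[s qs]]]] := H t1; first exact: thpt_in xq.
  by exists s; rewrite -qs.
apply: (fsubtree_down tree_of P F1 F2) => //.
  by move=> tF; exists p; rewrite (Prop_irrelevance tF t2); split=> //; left.
move=> F f _ F1F _ NFf IH tF.
have tF' := fsubtree_add tree_of F f tF (proj1 NFf).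
have [q [xq Hq]] := IH tF'.
exists (foldp f q); split; first exact: (thpt_fold _ (exist _ F tF) (exist _ _ tF')).
have [qf|qf] := EM (projT1 q = om f); last by rewrite foldp_id.
case: Hq => [bq|[s qs]]; last first.
  exfalso; apply: (proj2 NFf); rewrite /tomega.
  suff -> : talpha D (trev D f) = al e by apply: F1F; case: NFe.
  by rewrite -[LHS]qf qs.
have [s ->] := foldp_projT1 _ _ qf; rewrite /=.
have [F1f|nF1f] := EM (F1 (al f)).
  have NFf1 : NF D F1 f by split=> // /F1F; case: NFf.
  suff ef : e = f by right; subst f; exists s.
  apply: (beyond_unique tree_of F1 e f (om f)) => //; [by case: t1 => _ []|by rewrite -qf|].
  exists [::]; split=> //; split=> //; split=> //.
  by case: NFf1.
left; case: bq => w [ww [lw aw]]; exists (w ++ [:: al f]); split.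
  apply/walk_cat; split=> //; rewrite lw qf; split=> //.
  by exists (rv f); rewrite (tomega_rev tree_of).
split; first by rewrite last_cat.
apply/all_inP => z [<-|]; first by case: aw.
by move=> /(@List.in_app_or _ _ _ _)[zw|[<-|//]//]; case: aw => _ /all_inP; exact.
Qed.

Lemma thpt_common x y (F1 F2 : FT) p : sval F1 `<=` sval F2 -> thpt x F2 p -> thpt y F2 p ->
  exists q, thpt x F1 q /\ thpt y F1 q.
Proof.
case: F1 F2 => [F1 t1] [F2 t2] /= F12 xp yp.
pose P F := forall tF : fsubtree D F, exists q,
  thpt x (exist _ F tF) q /\ thpt y (exist _ F tF) q.
suff H : P F1 by exact: H.
apply: (fsubtree_down tree_of P F1 F2) => //.
  by move=> tF; exists p; rewrite (Prop_irrelevance tF t2).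
move=> F f _ F1F _ NFf IH tF.
have tF' := fsubtree_add tree_of F f tF (proj1 NFf).
have [q [xq yq]] := IH tF'.
by exists (foldp f q); split; apply: (thpt_fold _ (exist _ F tF) (exist _ _ tF')).
Qed.

(* Once no point over an edge leaving [F] represents the thread at [F], the thread is
   constant from [F] on. *)
Lemma thpt_stable x (F1 F2 : FT) u : sval F1 `<=` sval F2 -> thpt x F1 (KP u) ->
  (forall e s, NF D (sval F1) e -> ~ thpt x F1 (DP e s)) -> thpt x F2 (KP u).
Proof.
case: F1 F2 => [F1 t1] [F2 t2] /= F12 xu no.
pose P F := forall tF : fsubtree D F, thpt x (exist _ F tF) (KP u) /\
  forall e s, NF D F e -> ~ thpt x (exist _ F tF) (DP e s).
suff H : P F2 by case: (H t2).
apply: (fsubtree_up tree_of P F1 F2) => //.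
  by move=> tF; rewrite (Prop_irrelevance tF t1).
move=> F f tF F1F _ NFf /(_ tF) [xFu noF] tF'.
pose G : FT := exist _ F tF; pose G' : FT := exist _ _ tF'.
have fold p : thpt x G' p -> thpt x G (foldp f p) by exact: (thpt_fold _ G G').
(* A representative over the new vertex would fold into [Delta_f], which the assumption at [F]
   excludes. *)
have Gp p : thpt x G' p -> F (projT1 p).
  move=> xp; case: (thpt_in _ _ _ xp) => // pf; exfalso.
  have [s E] := foldp_projT1 _ _ pf.
  by apply: (noF f s) => //; rewrite -E; exact: fold.
have nf p : F (projT1 p) -> foldp f p = p.
  by move=> Fp; apply: foldp_id => E; case: NFf => _; apply; rewrite E in Fp.
split.
  have [p xp] := thpt_exists x G'.
  apply: (thpt_trans _ _ _ _ xp); last by left; exact: thpt_in xFu.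
  apply: (thpt_hq _ G); last exact: xFu.
  by rewrite -(nf p); [exact: fold|exact: Gp].
move=> e s NFe xe; apply: (noF e s).
  by split; [exact: (Gp _ xe)|move=> Fe; case: NFe => _; apply; left].
by rewrite -(nf (DP e s)); [exact: fold|exact: (Gp _ xe)].
Qed.

Lemma stabE x t y : stab Th X delta x t y <->
  exists F0 : FT, forall F : FT, sval F0 `<=` sval F -> thpt x F (KP (existT (tK D) t y)).
Proof. by []. Qed.

Lemma nonstab_edge x : ~ (exists t y, stab Th X delta x t y) ->
  forall F : FT, exists e s, NF D (sval F) e /\ thpt x F (DP e s).
Proof.
move=> ns F; apply: contrapT => no.
have [p xp] := thpt_exists x F.
suff [u pu] : exists u, p = KP u.
  apply: ns; exists (projT1 u), (projT2 u); apply/stabE; exists F => F' FF'.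
  apply: (thpt_stable _ F) => //; first by case: u pu => t y /= <-.
  by move=> e s NFe xe; apply: no; exists e, s.
have [//|[e [s E]]] := HP_case p.
have [Fe|Fe] := EM (sval F (om e)).
  have hs := thpt_inY _ _ _ xp e s Fe E.
  by exists (vphi e s); rewrite E; apply/esym/KP_DP.
exfalso; apply: no; exists e, s; rewrite -E; split=> //; split=> //.
by have := thpt_in _ _ _ xp; rewrite E.
Qed.

(** The last assumption makes [Q v] a point of [hat K_F] when [v] is the gate of [F], since no edge
    from [v] into [F] is then in [O]. Adding a vertex either keeps the gate or moves it along an
    edge of [O], where the assumption on [foldp] gives compatibility. *)
Lemma thread_of_flow (O : Edge Th -> Prop) (Q : Vert Th -> HP) :
  flow (D := D) O -> (forall v, projT1 (Q v) = v) ->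
  (forall e, O e -> Q (al e) = foldp e (Q (om e))) ->
  (forall v e s, Q v = DP e s -> Sper e s \/ O e) ->
  exists x : Thr, forall (F : FT) v, gate (D := D) O (sval F) v -> thpt x F (Q v).
Proof.
move=> fO Qv Qc Qs.
have QY F v : gate (D := D) O F v -> inY F (Q v).
  move=> [Fv gv] e s Fe E; have [//|Oe] := Qs _ _ _ E.
  exfalso; apply: (gv e _ Oe Fe).
  by have := congr1 (@projT1 _ _) E; rewrite Qv => ->.
have [g gP] : exists g : FT -> Vert Th, forall F, gate (D := D) O (sval F) (g F).
  suff /choice[g gP] : forall F : FT, exists v, gate (D := D) O (sval F) v by exists g.
  by move=> F; apply: (gate_exists tree_of) => //; exact: svalP.
have HP F : exists P : Piece Th X (sval F), sval P = Q (g F).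
  by apply: inY_piece; [rewrite Qv; case: (gP F)|exact: QY].
pose P F := sval (cid (HP F)); have PE F : sval (P F) = Q (g F) by exact: svalP (cid (HP F)).
have gE (F : FT) v : gate (D := D) O (sval F) v -> g F = v.
  by move=> gv; apply: (gate_unique tree_of (O : tE D -> Prop) (sval F)) => //; case: (svalP F) => _ [].
have comp : compatible Th X delta (fun F => hclass Th X (sval F) (P F)).
  move=> F1 F2 e Fe nFe E; exists (P F2), (P F1); split=> //; split=> //.
  have [_ [_ cF]] := svalP F1.
  have [[ge Oe]|nO] := EM (g F1 = al e /\ O e); last first.
    have gg : g F2 = g F1 by apply: gE; rewrite E; apply: (gate_stay tree_of).
    left; rewrite !PE gg; split=> //; rewrite Qv; by case: (gP F1).
  right; have gg : g F2 = om e by apply: gE; rewrite E; apply: (gate_move tree_of).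
  have [z Qz] : exists z, Q (om e) = existT hatK (om e) z.
    by have := Qv (om e); case: (Q (om e)) => t z /= te; subst t; exists z.
  exists z; rewrite !PE gg ge Qc // Qz foldp_om; split=> //.
  apply/hatKeE => s Es; rewrite -Qz in Es.
  by have [//|/(proj1 fO e)] := Qs _ _ _ Es.
exists (exist _ _ comp) => F v gv; exists (P F); split=> //.
by rewrite PE (gE F v).
Qed.


(** * The topology of the extended spaces *)

Local Notation Nt := (Nt Th).
Local Notation kpt := (kpt Th X).
Local Notation dpt := (dpt Th X).
Local Notation hat_open := (hat_open Th X).

Lemma open_local {T : topologicalType} (A : set T) :
  (forall y, A y -> exists N, [/\ open N, N y & N `<=` A]) -> open A.
Proof.
move=> H; rewrite openE => y /H[N [oN Ny NA]].
by rewrite /interior nbhsE; exists N.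
Qed.

Lemma open_avoid {T : topologicalType} {I : Type} (C : I -> set T) (L : seq I) y :
  (forall i, closed (C i)) -> exists M, [/\ open M, M y &
    forall i, List.In i L -> ~ C i y -> forall y', M y' -> ~ C i y'].
Proof.
move=> cC; elim: L => [|j L [M [oM My HM]]].
  by exists setT; split=> //; exact: openT.
have [Cy|Cy] := EM (C j y).
  by exists M; split=> // i [<-//|]; exact: HM.
exists (M `&` ~` C j); split=> //.
  by apply: openI => //; rewrite openC.
by move=> i [<- _ y' []//|iL Ciy y' [My' _]]; exact: HM Ciy _ My'.
Qed.

Definition Sg t (e : Nt t) : set (K Th t) := at_v (K Th) t (Sig Th (sval e)).

Lemma Sg_closed t (e : Nt t) : closed (Sg t e).
Proof.
case: e => e et; subst t; rewrite /Sg /=.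
have -> : at_v (K Th) (al e) (Sig Th e) = Sig Th e.
  rewrite eqEsubset; split=> x; first by move=> [y [sy E]]; rewrite -(existT_inj _ _ _ E).
  by move=> sx; exists x.
case: HT => _ [/(_ (al e))[hK _] [/(_ e)[cS _] _]].
exact: compact_closed.
Qed.

Lemma SgP t (e : Nt t) y : Sg t e y <-> inSig (sval e) (existT (tK D) t y).
Proof. by split=> -[x [sx E]]; exists x; rewrite -?E. Qed.

Lemma Sg_neq0 t (e : Nt t) : exists y, Sg t e y.
Proof.
case: e => e et; subst t; case: HT => _ [_ [/(_ e)[_ [x sx]] _]].
by exists x, x.
Qed.

Lemma Sg_inj t (e f : Nt t) y : Sg t e y -> Sg t f y -> e = f.
Proof. by move=> /SgP h1 /SgP h2; apply: sval_inj; exact: inSig_inj h1 h2. Qed.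

Lemma kpt_dpt t y (e : Nt t) s : kpt t y = dpt t e s <->
  Sper (sval e) s /\ existT (tK D) t y = vphi (sval e) s.
Proof.
split=> [E|/KP_DP E]; first by apply/KP_DP; rewrite -DPE -E.
by apply: existT_inj; rewrite DPE.
Qed.

Lemma kpt_dpt_Sg t y (e : Nt t) s : kpt t y = dpt t e s -> Sg t e y.
Proof. by move=> /kpt_dpt[hs E]; apply/SgP; rewrite E; exact: inSig_vphi. Qed.

Lemma Sg_kpt_dpt t y (e : Nt t) : Sg t e y -> exists s, Sper (sval e) s /\ kpt t y = dpt t e s.
Proof.
move=> /SgP/inSig_KP_DP[s [hs E]]; exists s; split=> //.
by apply/kpt_dpt/KP_DP.
Qed.

Lemma Sper_kpt t (e : Nt t) s : Sper (sval e) s -> exists y, kpt t y = dpt t e s.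
Proof.
case: e s => e et s hs; subst t; exists (varphi Th X e s).
by apply/kpt_dpt.
Qed.

Lemma kpt_inj t y y' : kpt t y = kpt t y' -> y = y'.
Proof.
move=> E; apply: (existT_inj (P := tK D)).
exact: (KP_inj (existT (tK D) t y) (existT (tK D) t y') (congr1 (existT hatK t) E)).
Qed.

Lemma dpt_inj t (e f : Nt t) s s' : dpt t e s = dpt t f s' -> e = f.
Proof.
move=> E; apply: sval_inj.
have E2 : DP (sval e) s = DP (sval f) s' by rewrite -!DPE E.
exact: (congr1 (@projT1 _ _) (DP_inj _ _ _ _ E2)).
Qed.

Lemma dpt_eq t (e : Nt t) s s' : dpt t e s = dpt t e s' -> s = s'.
Proof. by move=> E; apply: DP_eq; rewrite -!DPE E. Qed.

Lemma hat_class t (p : Pt (star Th X t)) :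
  (inl (qcl (equivF (star Th X t) setT) p) : hatK t) =
  match p with
  | existT None y => kpt t y
  | existT (Some e) s => dpt t e s
  end.
Proof. by case: p => [[e|] s]. Qed.

Lemma Sper_closed e : closed (Sper e).
Proof. by case: (ext_of e) => hD [_ [cS _]]; exact: compact_closed. Qed.

(** The implication puts all points off [Sper e] into the set, which makes it open in [Delta_e] and
    not merely in [Sper e]. *)
Lemma varphi_slice_open e (O : set (K Th (al e))) : open O ->
  open [set s | Sper e s -> O (varphi Th X e s)].
Proof.
move=> oO; case: (ext_of e) => _ [_ [_ [cv _]]].
have oO' : open ((varphi Th X e @^-1` O) : set (subspace (Sper e))).
  by move/continuousP: cv; exact.
have [V oV VE] := proj1 (open_subspaceP _ _) oO'.
have -> : [set s | Sper e s -> O (varphi Th X e s)] = V `|` ~` Sper e.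
  rewrite eqEsubset; split=> s /= H.
    have [hs|hs] := EM (Sper e s); last by right.
    left; suff: (V `&` Sper e) s by case.
    by rewrite VE; split=> //; exact: H.
  case: H => // Vs hs.
  suff: (varphi Th X e @^-1` O `&` Sper e) s by case.
  by rewrite -VE.
by apply: openU => //; rewrite openC; exact: Sper_closed.
Qed.

(** Nullity enters here. Around [y], a peripheral subspace of diameter below [eps / 2] that meets
    the ball of radius [eps / 2] stays in [N]; the finitely many larger ones not containing [y] are
    avoided. The list [l] exempts edges that will belong to a subtree of the star, for which no
    saturation is required. *)
Lemma Sg_saturated_open t (N : set (K Th t)) (l : seq (Nt t)) : open N ->
  open [set y | N y /\ forall e : Nt t, ~ List.In e l -> Sg t e y -> Sg t e `<=` N].
Proof.
move=> oN; apply: open_local => y [Ny Hy].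
have [eps eps0 ballN] : exists2 eps : R, 0 < eps & ball y eps `<=` N.
  by apply/nbhs_ballP; exact: open_nbhs_nbhs.
have nf : null_fam (fun e : Nt t => Sg t e) by case: HT => _ [_ [_ [_ [_ [_ /(_ t)]]]]].
have e20 : 0 < eps / 2 by rewrite divr_gt0.
have [L HL] := finite_list _ (nf _ e20).
have [M [oM My HM]] := open_avoid (Sg t) L y (Sg_closed t).
exists (M `&` (ball y (eps / 2))°); split.
- by apply: openI => //; exact: open_interior.
- by split=> //; exact: nbhsx_ballx.
move=> y' [My' /interior_subset by'].
have split2 z : ball y' (eps / 2) z -> N z.
  by move=> bz; apply: ballN; rewrite (splitr eps); exact: ball_triangle by' bz.
split; first by apply: split2; exact: ballxx.
move=> e el Sy' z Sz; have [Sy|Sy] := EM (Sg t e y); first exact: Hy Sz.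
apply: split2; apply: contrapT => nb.
by apply: (HM e _ Sy y' My') => //; apply: HL; exists y', z.
Qed.

Lemma star_adj t (u v : option (Nt t)) : adj (star Th X t) u v ->
  (u = None /\ exists e, v = Some e) \/ (v = None /\ exists e, u = Some e).
Proof.
move=> [[[] e] [/= <- <-]]; [left|right]; by split=> //; exists e.
Qed.

Lemma star_subtree t (F : set (option (Nt t))) : fsubtree (star Th X t) F -> ~ F None ->
  exists e, F = [set Some e].
Proof.
move=> [_ [[[e|//] Fe] cF]] nF; exists e; rewrite eqEsubset; split=> [v Fv|v ->//].
have [s [ws [<- /all_inP sF]]] := cF _ _ Fe Fv.
case: s ws sF => //= a s [/star_adj[[]//|[a0 _]] _] sF.
by exfalso; apply: nF; rewrite -a0; apply: sF; left.
Qed.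

Lemma equivF_star t F (p q : Pt (star Th X t)) : equivF (star Th X t) F p q ->
  p = q \/ [/\ F None, F (projT1 p), F (projT1 q) & core t p = core t q].
Proof.
elim=> {p q} [p q|p|p q _|p q r _ H1 _ H2].
- move=> g; right; have c : core t p = core t q.
    apply/core_equiv; apply: rst_step.
    by case: g => e [x [y [_ [_ H]]]]; exists e, x, y.
  by case: g c => -[[] e] [x [y [/= Fa [Fo [_ [-> ->]]]]]] c; split.
- by left.
- by case=> [->|[? ? ? ?]]; [left|right; split].
- case: H1 => [->//|[a b c d]]; case: H2 => [<-|[a' b' c' d']]; right; split=> //.
  by rewrite d.
Qed.

Lemma star_equivF t (F : set (option (Nt t))) (e : Nt t) s y : F None -> F (Some e) ->
  kpt t y = dpt t e s ->
  equivF (star Th X t) F (existT (tK (star Th X t)) (Some e) s)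
    (existT (tK (star Th X t)) None y).
Proof.
by move=> Fn Fe /kpt_dpt[hs E]; apply: rst_step; exists (false, e), s, y.
Qed.

Lemma star_beyond t (F : set (option (Nt t))) b v : F None -> NF (star Th X t) F b ->
  beyond (star Th X t) F b v -> exists e, [/\ b = (true, e), v = Some e & ~ F (Some e)].
Proof.
move=> Fn [Fa Fo] [s [ws [<- /all_inP sF]]].
case: b Fa Fo ws sF => -[] e //= _ Fo ws sF.
exists e; split=> //; case: s ws sF => //= a s [/star_adj[[]//|[a0 _]] _] sF.
by exfalso; apply: (sF a); [right; left|rewrite a0].
Qed.

(* The last clause says that near a point of [K_t] all but finitely many of the [Delta_e]
   that come close lie in [W] entirely. *)
Definition hat_basis t (W : set (hatK t)) := [/\ open (kpt t @^-1` W),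
  forall e, open (dpt t e @^-1` W) &
  forall y, W (kpt t y) -> exists N (l : seq (Nt t)), [/\ open N, N y &
    forall e y', N y' -> Sg t e y' -> ~ (forall s, W (dpt t e s)) -> List.In e l]].

Lemma lim_open_hat_basis t W : hat_open t W -> hat_basis t W.
Proof.
move=> oW.
(* Every point of [W] has a basic neighbourhood of one of two shapes. *)
have key z : W z -> (exists (U0 : set (K Th t)) l (Ud : forall e, set (Delta Th X (sval e))),
    [/\ open U0, (forall y, z = kpt t y -> U0 y) /\ (forall y, U0 y -> W (kpt t y)),
      (forall e, List.In e l -> [/\ open (Ud e), (forall s, z = dpt t e s -> Ud e s) &
         forall s, Ud e s -> W (dpt t e s)]) &
      forall e, ~ List.In e l -> (forall s, z = dpt t e s -> Sg t e `<=` U0) /\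
        (forall y, U0 y -> Sg t e y -> forall s, W (dpt t e s))])
    \/ (exists e0 (U1 : set (Delta Th X (sval e0))), [/\ open U1,
      (forall s, z = dpt t e0 s -> U1 s), (forall s, U1 s -> W (dpt t e0 s)) &
      forall e y, (z = kpt t y \/ exists s, e <> e0 /\ z = dpt t e s) ->
        (forall y, W (kpt t y)) /\ (forall f, f <> e0 -> forall s, W (dpt t f s))]).
  move=> /oW[F [U [[tF [UF [sU [oU NU]]]] [Gz GW]]]].
  have GWk y p : sval (qcl (equivF (star Th X t) setT) (existT (tK (star Th X t)) None y)) p ->
      (U p \/ exists b, NF (star Th X t) F b /\
        tSig (star Th X t) b `<=` sliceU (star Th X t) U (talpha (star Th X t) b) /\
        beyond (star Th X t) F b (projT1 p)) -> W (kpt t y).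
    by move=> yp H; apply: GW; exists p.
  have GWd e s p : sval (qcl (equivF (star Th X t) setT) (existT (tK (star Th X t)) (Some e) s)) p ->
      (U p \/ exists b, NF (star Th X t) F b /\
        tSig (star Th X t) b `<=` sliceU (star Th X t) U (talpha (star Th X t) b) /\
        beyond (star Th X t) F b (projT1 p)) -> W (dpt t e s).
    by move=> yp H; apply: GW; exists p.
  have Gp : exists p : Pt (star Th X t), z = inl (qcl (equivF (star Th X t) setT) p) /\
      (U p \/ exists b, NF (star Th X t) F b /\
        tSig (star Th X t) b `<=` sliceU (star Th X t) U (talpha (star Th X t) b) /\
        beyond (star Th X t) F b (projT1 p)).
    case: z Gz => [c [p [cp H]]|/star_no_end//]; exists p; split=> //; congr inl.
    by apply/(qcl_mem _ _ _ (crst_equivalence _)).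
  have [p [zp Hp]] := Gp; rewrite hat_class in zp.
  (* With the centre in the subtree, the neighbourhood restricts to open sets on [K_t] and on
     finitely many [Delta_e]; any other [Delta_e] whose peripheral subspace it meets in [K_t] lies
     in it entirely. *)
  have [Fn|nFn] := EM (F None).
    left; have [l Hl] := finite_list _ (proj1 tF).
    have [l' Hl'] : exists l' : seq (Nt t), forall e, F (Some e) <-> List.In e l'.
      have [l1 Hl1] : exists l1 : seq (Nt t), forall e, List.In (Some e) l <-> List.In e l1.
        elim: l {Hl} => [|[a|] l [l1 IH]]; first by exists [::].
          exists (a :: l1) => e; split=> [[[->]|/IH ?]|[->|/IH ?]];
            [by left|by right|by left|by right].
        by exists l1 => e; split=> [[//|/IH]//|/IH ?]; right.
      have [l2 Hl2] : exists l2, forall e, List.In e l2 <-> List.In e l1 /\ F (Some e).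
        elim: l1 {Hl1} => [|a l1 [l2 IH]]; first by exists [::] => e; split=> [|[]].
        have [Fa|Fa] := EM (F (Some a)).
          exists (a :: l2) => e; split=> [[<-|/IH[? ?]]|[[<-|?] ?]].
          - by split=> //; left.
          - by split=> //; right.
          - by left.
          - by right; apply/IH.
        exists l2 => e; split=> [/IH[? ?]|[[ae|?] Fe]]; first by split=> //; right.
          by exfalso; apply: Fa; rewrite ae.
        by apply/IH.
      exists l2 => e; split=> [Fe|/Hl2[]//]; apply/Hl2; split=> //.
      by apply/Hl1/Hl.
    pose U0 := [set y | U (existT (tK (star Th X t)) None y)].
    exists U0, l', (fun e => [set s | U (existT (tK (star Th X t)) (Some e) s)]); split.
    - exact: (oU None Fn).
    - split=> y.
        move=> zy; case: Hp => [Up|[b [NFb [Sb bb]]]].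
          case: p zp Up => [[e|] s] zp Up; last by rewrite zy in zp; rewrite /U0 /= (kpt_inj _ _ _ zp).
          apply: (sU _ _ Up); apply: star_equivF => //; first exact: (UF _ Up).
          by rewrite -zp.
        have [e [bE pe nFe]] := star_beyond _ _ _ _ Fn NFb bb.
        case: p zp pe bb => [v s] /= + pe; subst v => zp _.
        rewrite zp in zy; subst b; apply: Sb; exact: (kpt_dpt_Sg _ _ _ _ (esym zy)).
      by move=> Uy; apply: (GWk y (existT _ None y)); [exact: rst_refl|left].
    - move=> e /Hl' Fe; split; first exact: (oU (Some e) Fe).
        move=> s zs; case: Hp => [Up|[b [NFb [Sb bb]]]].
          case: p zp Up => [[f|] s'] zp Up; rewrite zp in zs.
            have ef := dpt_inj _ _ _ _ _ zs; subst f.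
            by rewrite /= -(dpt_eq _ _ _ _ zs).
          by apply: (sU _ _ Up); apply: rst_sym; apply: star_equivF.
        have [f [bE pf nFf]] := star_beyond _ _ _ _ Fn NFb bb.
        case: p zp pf bb => [v s'] /= + pf; subst v => zp _.
        by rewrite zp in zs; have ef := dpt_inj _ _ _ _ _ zs; subst f.
      by move=> s Us; apply: (GWd e s (existT _ (Some e) s)); [exact: rst_refl|left].
    move=> e /Hl' nFe.
    have NFe : NF (star Th X t) F (true, e) by [].
    split.
      move=> s zs; case: Hp => [Up|[b [NFb [Sb bb]]]].
        case: p zp Up => [[f|] s'] zp Up; rewrite zp in zs.
          have ef := dpt_inj _ _ _ _ _ zs; subst f.
          by exfalso; apply: nFe; exact: (UF _ Up).
        case: (NU _ NFe) => //= N0; exfalso.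
        suff : (tSig (star Th X t) (true, e) `&` sliceU (star Th X t) U None) s' by rewrite N0.
        by split=> //; exact: kpt_dpt_Sg zs.
      have [f [bE pf nFf]] := star_beyond _ _ _ _ Fn NFb bb.
      case: p zp pf bb => [v s'] /= + pf; subst v => zp _.
      by rewrite zp in zs; have ef := dpt_inj _ _ _ _ _ zs; subst f b.
    move=> y Uy Sy s; apply: (GWd e s (existT _ (Some e) s)); first exact: rst_refl.
    right; exists (true, e); split=> //; split; last by exists [::].
    case: (NU _ NFe) => //= N0; exfalso.
    suff : (tSig (star Th X t) (true, e) `&` sliceU (star Th X t) U None) y by rewrite N0.
    by [].
  (* The subtree is a single leaf, left only by the edge [(false, e0)]. If the neighbourhood
     contains a point of [K_t] or of another [Delta_e], it contains all of these. *)
  right; have [e0 FE] := star_subtree _ _ tF nFn.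
  pose U1 := [set s | U (existT (tK (star Th X t)) (Some e0) s)].
  have Fe0 : F (Some e0) by rewrite FE.
  have full b : NF (star Th X t) F b -> b = (false, e0).
    by case: b => -[] e [] /=; rewrite FE // => -[->].
  have bey v : v <> Some e0 -> beyond (star Th X t) F (false, e0) v.
    case: v => [e|] ve.
      exists [:: Some e]; split; first by split=> //; exists (true, e).
      by split=> //; rewrite FE.
    by exists [::]; rewrite FE.
  have NF0 : NF (star Th X t) F (false, e0) by split.
  exists e0, U1; split.
  - exact: (oU (Some e0) Fe0).
  - move=> s zs; case: Hp => [Up|[b [NFb [Sb bb]]]].
      case: p zp Up => [[f|] s'] zp Up; rewrite zp in zs; last by case: nFn; exact: (UF _ Up).
      have ef := dpt_inj _ _ _ _ _ zs; subst f.
      by rewrite /U1 /= -(dpt_eq _ _ _ _ zs).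
    have be := full _ NFb; subst b.
    apply: Sb => /=; case: bb => w [ww [wl /all_inP ow]].
    case: p zp wl => [[f|] s'] zp wl; rewrite zp in zs; last by case/kpt_dpt: zs.
    have ef := dpt_inj _ _ _ _ _ zs; subst f.
    by exfalso; apply: (ow _ (In_last _ w)); rewrite wl FE.
  - by move=> s Us; apply: (GWd e0 s (existT _ (Some e0) s)); [exact: rst_refl|left].
  move=> e y Hz.
  have Sb : Sper (sval e0) `<=` U1.
    have [//|N0] := NU _ NF0.
    have H0 s : Sper (sval e0) s -> U1 s -> Sper (sval e0) `<=` U1.
      move=> hs Us; exfalso.
      suff : (tSig (star Th X t) (false, e0) `&` sliceU (star Th X t) U (Some e0)) s by rewrite N0.
      by split.
    case: Hp => [Up|[b [NFb [Sb bb]]]]; last by rewrite (full _ NFb) in Sb.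
    case: p zp Up => [[f|] s'] zp Up; last by case: nFn; exact: (UF _ Up).
    have ef : f = e0 by have := UF _ Up; rewrite FE => -[].
    subst f; apply: (H0 s') => //.
    case: Hz => [zy|[s [ee zs]]]; last by rewrite zp in zs; case: ee; rewrite (dpt_inj _ _ _ _ _ zs).
    by rewrite zp in zy; case/kpt_dpt: (esym zy).
  split.
    move=> y'; apply: (GWk y' (existT _ None y')); first exact: rst_refl.
    by right; exists (false, e0); split=> //; split=> //; exact: bey.
  move=> f fe s; apply: (GWd f s (existT _ (Some f) s)); first exact: rst_refl.
  right; exists (false, e0); split=> //; split=> //; apply: bey.
  by move=> [].
split.
- apply: open_local => y Wy; have [] := key _ Wy.
    move=> [U0 [l [Ud [oU0 [U0y U0W] _ _]]]]; exists U0; split=> //; exact: U0y.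
  move=> [e0 [U1 [_ _ _ H]]]; exists setT; split=> //; first exact: openT.
  by move=> y' _; have [H1 _] := H e0 y (or_introl erefl); exact: H1.
- move=> e; apply: open_local => s Ws; have [] := key _ Ws.
    move=> [U0 [l [Ud [oU0 [U0y U0W] inl_ nl]]]].
    have [el|el] := EM (List.In e l).
      by have [oU Us UW] := inl_ e el; exists (Ud e); split=> //; exact: Us.
    have [/(_ s erefl) SU HU] := nl e el.
    have [y Sy] := Sg_neq0 t e.
    exists setT; split=> //; first exact: openT.
    by move=> s' _; apply: (HU y) => //; exact: SU.
  move=> [e0 [U1 [oU1 U1s U1W H]]].
  have [ee|ee] := EM (e = e0).
    by subst e; exists U1; split=> //; exact: U1s.
  have [y _] := Sg_neq0 t e.
  have [|_ H2] := H e y; first by right; exists s.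
  by exists setT; split=> //; [exact: openT|move=> s' _; exact: H2].
- move=> y Wy; have [] := key _ Wy.
    move=> [U0 [l [Ud [oU0 [U0y U0W] inl_ nl]]]]; exists U0, l; split=> //; first exact: U0y.
    move=> e y' U0y' Sy' nW; apply: contrapT => el; apply: nW.
    by have [_ HU] := nl e el; exact: HU Sy'.
  move=> [e0 [U1 [oU1 U1s U1W H]]]; exists setT, [:: e0]; split=> //; first exact: openT.
  move=> e y' _ _ nW; left; apply: contrapT => ee; apply: nW.
  have [|_ H2] := H e y; first by left.
  by apply: H2 => E; apply: ee.
Qed.

Lemma kpt_slice_open t (e : Nt t) (O : set (K Th t)) : open O ->
  open [set s | forall y, kpt t y = dpt t e s -> O y].
Proof.
case: e => e et; subst t => oO.
have -> : [set s | forall y, kpt (al e) y = dpt (al e) (exist _ e erefl) s -> O y] =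
    [set s | Sper e s -> O (varphi Th X e s)].
  rewrite eqEsubset; split=> s /= H.
    by move=> hs; apply: H; apply/kpt_dpt.
  by move=> y /kpt_dpt [hs E]; rewrite (existT_inj _ _ _ E); exact: H.
exact: varphi_slice_open.
Qed.

Lemma star_fsubtree t (l : seq (Nt t)) : fsubtree (star Th X t)
  [set v : option (Nt t) | match v with None => True | Some e => List.In e l end].
Proof.
split.
  apply: (sub_finite_set _ (finite_set_In (None :: map Some l))).
  by move=> [e|] /= H; [right; exact: List.in_map|left].
split; first by exists None.
have ad e : adj (star Th X t) (Some e) None by exists (false, e).
have da e : adj (star Th X t) None (Some e) by exists (true, e).
move=> [e|] [f|] /= He Hf.
- by exists [:: None; Some f].
- by exists [:: None].
- by exists [:: Some f].
- by exists [::].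
Qed.

Lemma hat_basis_open t W : hat_basis t W -> hat_open t W.
Proof.
move=> [K1 K2 K3] z Wz.
have [[y zy]|nk] := EM (exists y, z = kpt t y).
  rewrite zy in Wz; subst z.
  have [N [l [oN Ny Nl]]] := K3 _ Wz.
  (* The edge whose peripheral subspace contains [y], if any, is added to the exceptional ones, so
     that the saturation condition in [U0] is vacuous at [y]. *)
  have [l' ll' yl'] : exists2 l', (forall e, List.In e l -> List.In e l') &
      forall e, Sg t e y -> List.In e l'.
    have [[e ey]|ne] := EM (exists e, Sg t e y).
      by exists (e :: l) => f; [right|move=> fy; left; exact: Sg_inj ey fy].
    by exists l => // e ey; case: ne; exists e.
  pose N' := N `&` (kpt t @^-1` W).
  have oN' : open N' by exact: openI.
  pose U0 := [set y | N' y /\ forall e : Nt t, ~ List.In e l' -> Sg t e y -> Sg t e `<=` N'].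
  pose F := [set v : option (Nt t) | match v with None => True | Some e => List.In e l' end].
  pose U : set (Pt (star Th X t)) := fun p => match p with
    | existT None y => U0 y
    | existT (Some e) s => [/\ List.In e l', W (dpt t e s) & forall y, kpt t y = dpt t e s -> U0 y]
    end.
  have NFE b : NF (star Th X t) F b -> exists e, b = (true, e) /\ ~ List.In e l'.
    by case: b => -[] e [] //= _ ne; exists e.
  have SgU0 e y1 : ~ List.In e l' -> Sg t e y1 -> U0 y1 -> Sg t e `<=` U0.
    move=> el Sy1 [_ /(_ e el Sy1)SN] y2 Sy2; split; first exact: SN.
    by move=> f fl Sf; rewrite -(Sg_inj _ _ _ _ Sy2 Sf).
  exists F, U; split; [split; [exact: star_fsubtree|split; [|split; [|split]]]|split].
  - by move=> [[e|] s] // [].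
  - move=> p q Up /equivF_star[<-//|[_ _ Fq /hat_eq]]; rewrite !hat_class.
    case: p Up => [[e|] s]; case: q Fq => [[f|] s'] Fq /= Up E.
    + by have ef := dpt_inj _ _ _ _ _ E; subst f; rewrite -(dpt_eq _ _ _ _ E).
    + by case: Up => _ _; exact.
    + split=> //; first by rewrite -E; case: Up => -[].
      by move=> y1; rewrite -E => /kpt_inj ->.
    + by rewrite -(kpt_inj _ _ _ E).
  - move=> [e|] Fv; last exact: Sg_saturated_open.
    have -> : sliceU (star Th X t) U (Some e) =
        dpt t e @^-1` W `&` [set s | forall y, kpt t y = dpt t e s -> U0 y].
      by rewrite eqEsubset; split=> s; [case|case=> ? ?; split].
    apply: openI; first exact: K2.
    by apply: (kpt_slice_open t e U0); exact: Sg_saturated_open.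
  - move=> b /NFE[e [-> el]].
    have [[y1 [Sy1 Uy1]]|no] := EM (exists y1, Sg t e y1 /\ U0 y1).
      by left; exact: SgU0 Uy1.
    right; rewrite -subset0 => y1 [Sy1 Uy1]; by apply: no; exists y1.
  - exists (existT (tK (star Th X t)) None y); split; first exact: rst_refl.
    by left; split=> // e el /yl'.
  move=> [c|/star_no_end//] [p [/(qcl_mem _ _ _ (crst_equivalence _)) -> Hp]].
  rewrite hat_class; case: Hp => [|[b [NFb [Sb bb]]]].
    by case: p => [[e|] s] => [[]|[[]]].
  have [e [be pe nFe]] := star_beyond _ _ _ _ I NFb bb.
  case: p pe {bb} => [v s] /= pe; subst v b.
  have [y1 Sy1] := Sg_neq0 t e.
  apply: contrapT => nW; apply: nFe; apply: ll'; apply: (Nl e y1) => //.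
    by case: (Sb y1 Sy1) => -[].
have [/nk//|[e [s zs]]] := hatK_case t z.
(* Off [K_t] a single leaf suffices: with [Sper] removed, the set misses the only peripheral
   subspace, and the basic set contains nothing beyond it. *)
pose F := [set Some e : option (Nt t)].
pose U : set (Pt (star Th X t)) := fun p => match p with
  | existT None y => False
  | existT (Some f) s => [/\ f = e, W (dpt t f s) & ~ Sper (sval f) s]
  end.
have ns : ~ Sper (sval e) s.
  by move=> /Sper_kpt[y ys]; apply: nk; exists y; rewrite ys.
exists F, U; split; [split; [exact: fsubtree1|split; [|split; [|split]]]|split].
- by move=> [[f|] s'] // [fe _ _]; rewrite /F /= fe.
- by move=> p q Up /equivF_star[<-//|[]].
- move=> v ->.
  have -> : sliceU (star Th X t) U (Some e) = dpt t e @^-1` W `&` ~` Sper (sval e).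
    by rewrite eqEsubset; split=> s'; [case|case=> ? ?; split].
  by apply: openI; [exact: K2|exact: closed_openC (Sper_closed _)].
- move=> [[] f] [] //= [fe] _; rewrite fe; right; rewrite -subset0.
  by move=> s' [hs' [_ _ ns']]; exact: ns' hs'.
- rewrite zs; exists (existT (tK (star Th X t)) (Some e) s); split; first exact: rst_refl.
  by left; split=> //; rewrite -zs.
move=> [c|/star_no_end//] [p [/(qcl_mem _ _ _ (crst_equivalence _)) -> Hp]].
rewrite hat_class; case: Hp => [|[[[] f] [[//= fe _] [Sb _]]]].
  by case: p => [[f|] s'] => [[]|].
have [y Sy] := Sg_neq0 t f; have [s' [hs' _]] := Sg_kpt_dpt _ _ _ Sy.
by have [_ _] := Sb s' hs'.
Qed.

(** The description [hat_basis] is stable under intersection clause by clause, whereas basic sets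
    over different subtrees of the star would first have to be compared. *)
Lemma hat_openI t W1 W2 : hat_open t W1 -> hat_open t W2 -> hat_open t (W1 `&` W2).
Proof.
move=> /lim_open_hat_basis[A1 A2 A3] /lim_open_hat_basis[B1 B2 B3].
apply: hat_basis_open; split.
- exact: openI A1 B1.
- by move=> e; exact: openI (A2 e) (B2 e).
move=> y [/A3[N1 [l1 [o1 y1 H1]]] /B3[N2 [l2 [o2 y2 H2]]]].
exists (N1 `&` N2), (l1 ++ l2); split=> //; first exact: openI.
move=> e y' [N1y N2y] Sy nW; apply: List.in_or_app.
have [W1e|W1e] := EM (forall s, W1 (dpt t e s)); last by left; exact: H1 N1y Sy W1e.
by right; apply: H2 N2y Sy _ => W2e; apply: nW => s; split.
Qed.

(** * Open sets of the spaces in the inverse system *)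

Definition inF (F : set (Vert Th)) (p : HP) := F (projT1 p) /\ inY F p.

Lemma thpt_inF x F p : thpt x F p -> inF (sval F) p.
Proof. by move=> xp; split; [exact: thpt_in xp|exact: thpt_inY xp]. Qed.

(** An open subset of [hat K_F], given by representatives. It is determined by [O] on [inF F]; the
    values elsewhere only serve to make the traces open in the whole of [hat K_t]. *)
Definition fopen (F : set (Vert Th)) (O : set HP) :=
  (forall t, F t -> hat_open t [set z | O (existT hatK t z)]) /\
  (forall p q, inF F p -> inF F q -> hq p q -> O p -> O q).

Definition hatset (F : set (Vert Th)) (O : set HP) : set (HatF Th X F) :=
  [set c | exists P, c = hclass Th X F P /\ O (sval P)].

Lemma fopen_hatF_open (F : FT) O : fopen (sval F) O ->
  hatF_open Th X (sval F) (hatset (sval F) O) /\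
  forall x p, thpt x F p -> (hatset (sval F) O (sval x F) <-> O p).
Proof.
move=> [oO iO].
have inP (P : Piece Th X (sval F)) : inF (sval F) (sval P).
  by split; [case: (svalP P)|exact: piece_inY].
have WE P : hatset (sval F) O (hclass Th X (sval F) P) <-> O (sval P).
  split=> [[Q [/hclassE PQ OQ]]|OP]; last by exists P.
  exact: (iO _ _ _ _ (hq_sym _ _ PQ)).
split; last by move=> x p [P [<- ->]]; exact: WE.
exists (fun t z => O (existT hatK t z)); split=> // P.
by rewrite WE; case: (sval P).
Qed.

Lemma hatF_open_fopen (F : FT) W : hatF_open Th X (sval F) W -> exists O, fopen (sval F) O /\
  forall x p, thpt x F p -> (W (sval x F) <-> O p).
Proof.
move=> [O [oO OE]]; exists [set p | O (projT1 p) (projT2 p)]; split; last first.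
  by move=> x p [P [<- ->]]; exact: OE.
split=> // p q [Fp Yp] [Fq Yq] pq Op.
have [P EP] := inY_piece _ _ Fp Yp; have [Q EQ] := inY_piece _ _ Fq Yq.
subst p q; apply/OE.
have /hclassE <- := pq; exact/OE.
Qed.

Lemma fopenI F O1 O2 : fopen F O1 -> fopen F O2 -> fopen F (O1 `&` O2).
Proof.
move=> [o1 i1] [o2 i2]; split=> [t Ft|p q ip iq pq [? ?]].
  exact: hat_openI (o1 t Ft) (o2 t Ft).
by split; [exact: i1 pq _|exact: i2 pq _].
Qed.

Lemma fopenT F : fopen F setT.
Proof.
split=> // t _; apply: hat_basis_open; split=> [|e|y _].
- exact: openT.
- exact: openT.
by exists setT, [::]; split=> //; exact: openT.
Qed.

Lemma fopen_DP F O e : fopen F O -> F (al e) -> open [set s | O (DP e s)].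
Proof.
move=> [oO _] Fe; have [_ /(_ (exist _ e erefl)) H _] := lim_open_hat_basis _ _ (oO _ Fe).
exact: H.
Qed.

(** Continuity of the one-vertex bonding map. Over [om e] the preimage under [delta e] is prescribed
    on [hatKe] only, and an open set [W] of the whole extended space extends it. *)
Lemma fopen_fold (F : set (Vert Th)) O e : tconn (D := D) F -> NF D F e -> fopen F O ->
  exists O', fopen (F `|` [set om e]) O' /\
    forall p, inF (F `|` [set om e]) p -> (O' p <-> O (foldp e p)).
Proof.
move=> cF NFe fO; have [Fe nFe] := NFe; have [oO iO] := fO.
have [/(_ _ (fopen_DP _ _ _ fO Fe))[W [oW WE]] _] := proj2 HE e.
pose O' : set HP := [set p | (projT1 p <> om e /\ O p) \/
   exists z, p = existT hatK (om e) z /\ W z].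
have O'E p : inF (F `|` [set om e]) p -> (O' p <-> O (foldp e p)).
  move=> [Fp Yp]; have [pe|pe] := EM (projT1 p = om e); last first.
    rewrite foldp_id //; split=> [[[]//|[z [pz _]]]|Op]; last by left.
    by case: pe; rewrite pz.
  case: p pe Fp Yp => t z /= te; subst t => Fp Yp; rewrite foldp_om.
  have hz : hatKe Th X e z.
    by apply/hatKeE => s; apply: Yp; left; rewrite omega_rev.
  apply: (iff_trans _ (WE z hz)); split=> [[[]//|[z' [E Wz']]]|Wz].
    by rewrite (existT_inj _ _ _ E).
  by right; exists z.
exists O'; split=> //; split.
  move=> t Ft; have [te|te] := EM (t = om e).
    subst t; rewrite (_ : [set z | O' (existT hatK (om e) z)] = W) //.
    rewrite eqEsubset; split=> z; last by right; exists z.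
    by case=> [[]//|[z' [E Wz']]]; rewrite (existT_inj _ _ _ E).
  have {}Ft : F t by case: Ft.
  rewrite (_ : [set z | O' (existT hatK t z)] = [set z | O (existT hatK t z)]); first exact: oO.
  rewrite eqEsubset; split=> z; last by left.
  by case=> [[]//|[z' [E _]]]; case: te; exact: (congr1 (@projT1 _ _) E).
move=> p q ip iq pq /(O'E _ ip) Op; apply/(O'E _ iq).
have inf r : inF (F `|` [set om e]) r -> inF F (foldp e r).
  by move=> [? ?]; split; [exact: foldp_in|exact: foldp_inY].
apply: iO Op; [exact: inf|exact: inf|].
by apply: (foldp_hq F) => //; [case: ip|case: iq].
Qed.

Lemma fopen_sub (F1 F2 : FT) O : sval F1 `<=` sval F2 -> fopen (sval F1) O ->
  exists O', fopen (sval F2) O' /\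
    forall x p1 p2, thpt x F1 p1 -> thpt x F2 p2 -> (O' p2 <-> O p1).
Proof.
case: F1 F2 => [F1 t1] [F2 t2] /= F12 fO.
pose P F := forall tF : fsubtree D F, exists O', fopen F O' /\
  forall x p1 p2, thpt x (exist _ F1 t1) p1 -> thpt x (exist _ F tF) p2 -> (O' p2 <-> O p1).
suff H : P F2 by exact: H.
apply: (fsubtree_up tree_of P F1 F2) => //.
  move=> tF; exists O; split=> // x p1 p2 h1 h2; rewrite (Prop_irrelevance tF t1) in h2.
  have i1 := thpt_inF _ _ _ h1; have i2 := thpt_inF _ _ _ h2; have pq := thpt_hq _ _ _ _ h1 h2.
  by split; apply: (proj2 fO) => //; exact: hq_sym.
move=> F e tF _ _ NFe /(_ tF)[O1 [fO1 H1]] tF'.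
have [O2 [fO2 H2]] := fopen_fold F O1 e (proj2 (proj2 tF)) NFe fO1.
exists O2; split=> // x p1 p2 h1 h2.
apply: (iff_trans (H2 _ (thpt_inF _ _ _ h2))); apply: (H1 x) => //.
exact: (thpt_fold _ (exist _ F tF) (exist _ _ tF')).
Qed.

Lemma inSig_slice (U : set (Pt D)) e u : tSig D e `<=` sliceU D U (al e) -> inSig e u -> U u.
Proof. by move=> SU [x [sx ->]]; exact: SU. Qed.

Lemma Sig_neq0 e : exists u, inSig e u.
Proof. by case: HT => _ [_ [/(_ e)[_ [x sx]] _]]; exists (existT (tK D) (al e) x), x. Qed.

Lemma edges_list t (L : seq (Vert Th)) : exists l : seq (Nt t),
  forall e : Nt t, List.In (om (sval e)) L -> List.In e l.
Proof.
elim: L => [|v L [l IH]]; first by exists [::].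
have [[f fv]|nf] := EM (exists f : Nt t, om (sval f) = v).
  exists (f :: l) => e [ev|/IH]; last by right.
  left; apply: sval_inj; apply: (tedge_inj tree_of); first exact: (etrans (svalP f) (esym (svalP e))).
  by rewrite /tomega -[LHS]/(om (sval f)) fv ev.
by exists l => e [ev|/IH//]; case: nf; exists e.
Qed.

(* The trace on [hat K_F] of the basic open set [G(U)]. *)
Definition wU (F : set (Vert Th)) (U : set (Pt D)) : set HP :=
  [set p | (forall u, p = KP u -> U u) /\
    (forall e s, NF D F e -> p = DP e s -> tSig D e `<=` sliceU D U (al e))].

Lemma wU_KP F U u : basic_ok D F U -> U u -> wU F U (KP u).
Proof.
move=> [_ [_ [_ [_ NU]]]] Uu; split; first by move=> v /KP_inj <-.
move=> e s NFe /KP_DP_inSig eu; case: (NU e NFe) => // N0; exfalso.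
move: eu Uu => [x [sx ->]] Uu.
by suff : (tSig D e `&` sliceU D U (al e)) x by rewrite N0.
Qed.

Lemma wU_DP F U e s : NF D F e -> wU F U (DP e s) <-> tSig D e `<=` sliceU D U (al e).
Proof.
move=> NFe; split=> [[_]|SU]; first exact.
split; first by move=> u /esym/KP_DP_inSig; exact: inSig_slice.
by move=> f s' _ E; have /= <- := congr1 (@projT1 _ _) (DP_inj _ _ _ _ E).
Qed.

Lemma fopen_wU F U : basic_ok D F U -> fopen F (wU F U).
Proof.
move=> ok; have [tF [UF [sU [oU NU]]]] := ok; split; last first.
  move=> p q _ [Fq _] [->//|[e [u [v [g [pu qv]]]]]]; subst p q; move=> [Up _].
  apply: wU_KP => //; apply: (sU _ _ (Up _ erefl)).
  apply/equivFE; right; exists e; split; first by have := UF _ (Up _ erefl); case: g => x [_ [-> _]].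
  by split=> //; move: Fq; case: g => x [_ [_ ->]].
move=> t Ft; apply: hat_basis_open.
have Kw y : wU F U (existT hatK t (kpt t y)) <-> U (existT (tK D) t y).
  by split=> [[H _]|Uy]; [exact: H|exact: (wU_KP F U (existT (tK D) t y))].
have NFt (e : Nt t) : ~ F (om (sval e)) -> NF D F (sval e).
  by split=> //; rewrite [talpha _ _](svalP e).
split.
- rewrite (_ : _ @^-1` _ = sliceU D U t); first exact: oU.
  by rewrite eqEsubset; split=> y /Kw.
- move=> e; have [Fe|Fe] := EM (F (om (sval e))).
    rewrite (_ : _ @^-1` _ = [set s | forall y, kpt t y = dpt t e s -> sliceU D U t y]).
      by apply: kpt_slice_open; exact: oU.
    rewrite eqEsubset; split=> s /= Hs.
      by move=> y ys; apply/Kw; rewrite ys.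
    split; first by move=> [t' y'] E; have /= tt := congr1 (@projT1 _ _) E; subst t';
      apply: Hs; apply/esym; exact: existT_inj E.
    move=> f s' [_ Ff]; rewrite DPE => E; case: Ff.
    by have /= <- := congr1 (@projT1 _ _) (DP_inj _ _ _ _ E).
  have NFe := NFt _ Fe.
  have [SU|SU] := EM (tSig D (sval e) `<=` sliceU D U (al (sval e))).
    rewrite (_ : _ @^-1` _ = setT); first exact: openT.
    rewrite eqEsubset; split=> // s _ /=; rewrite DPE; exact/wU_DP.
  rewrite (_ : _ @^-1` _ = set0); first exact: open0.
  by rewrite -subset0 => s /=; rewrite DPE wU_DP.
(* The exceptional edges at [t] are those ending in [F]; along any other edge, saturation of [U]
   decides for the whole of [Delta_e] at once. *)
move=> y /Kw Uy; have [L HL] := finite_list _ (proj1 tF); have [l Hl] := edges_list t L.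
exists (sliceU D U t), l; split=> //; first exact: oU.
move=> e y' Uy' /SgP Sy' nW; apply: contrapT => el; apply: nW => s.
have NFe : NF D F (sval e) by apply: NFt => /HL/Hl.
rewrite /= DPE; apply/wU_DP => //; case: (NU _ NFe) => // N0; exfalso.
move: Sy' => [x [sx E]]; suff : (tSig D (sval e) `&` sliceU D U (al (sval e))) x by rewrite N0.
by split=> //; rewrite /sliceU /= -E.
Qed.

(** * Limits of threads *)

Local Notation eflow := (eflow (D := D)).
Local Notation limK u := (inl (qcl (equivF D setT) u) : LimPt D).

Lemma gate_out xi F e : NF D F e -> eflow xi e -> gate (eflow xi) F (al e).
Proof.
move=> [Fe nFe] xe; split=> // f fe xf.
by rewrite (proj2 (flow_eflow tree_of xi) f e).
Qed.

Lemma eflow_NF_unique xi F e f : tconn (D := D) F -> NF D F e -> NF D F f ->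
  eflow xi e -> eflow xi f -> e = f.
Proof.
move=> cF NFe NFf xe xf; apply: (proj2 (flow_eflow tree_of xi)) => //.
apply: (gate_unique tree_of _ F _ _ (flow_eflow tree_of xi) cF); exact: gate_out.
Qed.

Definition stabp (x : Thr) (u : Pt D) := stab Th X delta x (projT1 u) (projT2 u).

Lemma stabpE x u : stabp x u <->
  exists F0 : FT, forall F : FT, sval F0 `<=` sval F -> thpt x F (KP u).
Proof. by case: u. Qed.

Lemma FT_union (F1 F2 : FT) : exists F : FT, sval F1 `<=` sval F /\ sval F2 `<=` sval F.
Proof.
have [F [tF F1F F2F]] := fsubtreeU tree_of _ _ (svalP F1) (svalP F2).
by exists (exist _ F tF).
Qed.

Definition FT1 (v : Vert Th) : FT := exist _ [set v] (fsubtree1 (D := D) v).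

Lemma stabp_equiv x u v : stabp x u -> equivF D setT u v -> stabp x v.
Proof.
move=> /stabpE[F0 H] /equivFE [<-|[e [_ [_ g]]]]; first by apply/stabpE; exists F0.
have [F1 [F01 F1v]] := FT_union F0 (FT1 (projT1 v)).
apply/stabpE; exists F1 => F F1F; apply: (thpt_trans _ _ (KP u)).
- by apply: H => z /F01/F1F.
- by right; exists e, u, v.
- by apply: F1F; apply: F1v.
Qed.

Lemma stabp_unique x u v : stabp x u -> stabp x v -> equivF D setT u v.
Proof.
move=> /stabpE[F1 H1] /stabpE[F2 H2]; have [F [F1F F2F]] := FT_union F1 F2.
apply/equivFE.
have [E|[e [u' [v' [g [E1 E2]]]]]] := thpt_hq _ _ _ _ (H1 F F1F) (H2 F F2F).
  by left; exact: KP_inj.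
by right; exists e; rewrite (KP_inj _ _ E1) (KP_inj _ _ E2).
Qed.

Lemma stabp_inj x y u : stabp x u -> stabp y u -> x = y.
Proof.
move=> /stabpE[F1 H1] /stabpE[F2 H2]; have [F [F1F F2F]] := FT_union F1 F2.
apply: thr_ext => G; have [H [FH GH]] := FT_union F G.
apply: (thpt_common _ _ G H (KP u)) => //; [apply: H1|apply: H2] => z.
  by move/F1F/FH.
by move/F2F/FH.
Qed.

(** If the limit lies over a vertex off [F], beyond an edge [e], then the coordinate at [F] lies in
    [Delta_e] by [thpt_beyond], and both sides say that [Sigma_e] is contained in [U]. *)
Lemma Gset_stab x u F U p : stabp x u -> basic_ok D (sval F) U -> thpt x F p ->
  (Gset D (sval F) U (limK u) <-> wU (sval F) U p).
Proof.
move=> xu ok xp; have [tF [UF _]] := ok; have [_ iw] := fopen_wU _ _ ok.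
have tr q : thpt x F q -> (wU (sval F) U q <-> wU (sval F) U p).
  move=> xq; have i1 := thpt_inF _ _ _ xp; have i2 := thpt_inF _ _ _ xq.
  have pq := thpt_hq _ _ _ _ xp xq; split; apply: iw => //; exact: hq_sym.
split.
  move=> [v [/= uv Hv]].
  have /stabpE[F0 H] := stabp_equiv _ _ _ xu uv.
  have [F2 [F02 F2F]] := FT_union F0 F; have xv := H _ F02.
  case: Hv => [Uv|[e [NFe [Se be]]]].
    by apply/(tr (KP v)); [apply: thpt_sub xv _ => //; exact: (UF _ Uv)|exact: wU_KP].
  have [s xs] := thpt_beyond _ _ _ _ _ F2F xv NFe be.
  by apply/(tr _ xs)/wU_DP.
have /stabpE[F0 H] := xu.
have [F2 [F02 F2F]] := FT_union F0 F; have xv := H _ F02.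
move=> wp; exists u; split; first exact: rst_refl.
have [Fu|Fu] := EM (sval F (projT1 u)).
  have xFu : thpt x F (KP u) by apply: thpt_sub xv _.
  by left; have [H1 _] := proj2 (tr _ xFu) wp; exact: H1.
have [e [NFe be]] := beyond_exists tree_of _ _ tF Fu.
have [s xs] := thpt_beyond _ _ _ _ _ F2F xv NFe be.
right; exists e; split=> //; split=> //.
by apply/(wU_DP _ _ _ s NFe); apply/(tr _ xs).
Qed.

(** The relation [corr] in terms of representatives and flows. *)
Definition conv (x : Thr) (xi : End D) := forall F : FT, exists e s,
  [/\ NF D (sval F) e, eflow xi e & thpt x F (DP e s)].

Lemma Gset_conv x xi F U p : conv x xi -> basic_ok D (sval F) U -> thpt x F p ->
  (Gset D (sval F) U (inr xi) <-> wU (sval F) U p).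
Proof.
move=> cx ok xp; have [[_ [_ cF]] _] := ok; have [_ iw] := fopen_wU _ _ ok.
have [e [s [NFe xe xs]]] := cx F.
have tr : wU (sval F) U (DP e s) <-> wU (sval F) U p.
  have i1 := thpt_inF _ _ _ xp; have i2 := thpt_inF _ _ _ xs.
  have pq := thpt_hq _ _ _ _ xp xs; split; apply: iw => //; exact: hq_sym.
rewrite -tr wU_DP //; split.
  move=> [r [xr [f [NFf [Sf rf]]]]].
  by rewrite (eflow_NF_unique xi _ e f cF NFe NFf) //; exists r.
by move=> Se; have [r [xr rE]] := xe; exists r; split=> //; exists e.
Qed.

Lemma thpt_edge_unique x (F : FT) e f s s' : NF D (sval F) e ->
  thpt x F (DP e s) -> thpt x F (DP f s') -> DP f s' = DP e s.
Proof.
move=> NFe xe xf; apply: (DP_hq _ _ _ _ NFe); first exact: thpt_hq xe xf.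
exact: thpt_in xf.
Qed.

Lemma DP_edge e f s s' : DP e s = DP f s' -> e = f.
Proof. by move=> E; exact: (congr1 (@projT1 _ _) (DP_inj _ _ _ _ E)). Qed.

Lemma NF1 e : NF D [set al e] e.
Proof. by split=> // /esym; exact: alpha_omega. Qed.

Lemma conv_unique x xi xi' : conv x xi -> conv x xi' -> xi = xi'.
Proof.
move=> c c'; apply: (eflow_inj tree_of) => e xe.
have [e1 [s1 [N1 x1 t1]]] := c (FT1 (al e)); have [e2 [s2 [N2 x2 t2]]] := c' (FT1 (al e)).
rewrite (proj2 (flow_eflow tree_of xi) e e1) //; last by case: N1 => /= ->.
by rewrite -(DP_edge _ _ _ _ (thpt_edge_unique _ _ _ _ _ _ N1 t1 t2)).
Qed.

Lemma conv_step x xi (F : FT) e : conv x xi -> NF D (sval F) e -> eflow xi e ->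
  forall F' : FT, sval F' = sval F `|` [set om e] ->
  exists f s, [/\ NF D (sval F') f, eflow xi f, thpt x F' (DP f s) & al f = om e].
Proof.
move=> cx NFe xe F' FE; have [f [s [NFf xf xs]]] := cx F'; exists f, s; split=> //.
have [_ [_ cF']] := svalP F'; have [_ [_ cF]] := svalP F.
apply: (gate_unique tree_of _ (sval F') _ _ (flow_eflow tree_of xi) cF').
  exact: gate_out.
by rewrite FE; apply: (gate_move tree_of) => //; exact: (flow_eflow tree_of).
Qed.

Definition FTadd (F : FT) e (Fe : sval F (al e)) : FT :=
  exist _ (sval F `|` [set om e]) (fsubtree_add tree_of _ e (svalP F) Fe).

(** Adding [om e] moves the coordinate from [al e] to [om e], whereas a stable point keeps its
    vertex. *)
Lemma conv_nonstab x xi : conv x xi -> ~ (exists t y, stab Th X delta x t y).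
Proof.
move=> cx [t [y /stabE[F0 H]]].
have [e [s [NFe xe xs]]] := cx F0; pose F1 := FTadd F0 e (proj1 NFe).
have [f [s' [NFf xf xs' fe]]] := conv_step _ _ _ _ cx NFe xe F1 erefl.
have F01 : sval F0 `<=` sval F1 by move=> z; left.
have h0 := H F0 (fun _ h => h); have h1 := H F1 F01.
have E0 := DP_hq _ _ _ _ NFe (thpt_hq _ _ _ _ xs h0) (thpt_in _ _ _ h0).
have E1 := DP_hq _ _ _ _ NFf (thpt_hq _ _ _ _ xs' h1) (thpt_in _ _ _ h1).
have /= te := congr1 (@projT1 _ _) E0; have /= tf := congr1 (@projT1 _ _) E1.
by apply: (alpha_omega e); rewrite -fe -te -tf.
Qed.

Lemma conv_corr x xi : conv x xi -> corr Th X delta x xi.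
Proof.
move=> cx F; have [e [s [NFe [r [xr rE]] [P [EP xP]]]]] := cx F.
by exists e; split=> //; split; [exists P, s|exists r].
Qed.

(** An edge [e] joins the flow when the coordinate at [{al e}] lies in [Delta_e]. Whether [e] or its
    reversal does is read off at the subtree [{al e, om e}]: the coordinate there lies in some
    [Delta_g] over one of the two ends, and folding that end away puts it into [Delta] of the edge
    pointing to that end. *)
Lemma nonstab_conv x : ~ (exists t y, stab Th X delta x t y) -> exists xi, conv x xi.
Proof.
move=> /nonstab_edge ns.
pose O e := exists s, thpt x (FT1 (al e)) (DP e s).
have FO (F : FT) e s : NF D (sval F) e -> thpt x F (DP e s) -> O e.
  by move=> [Fe _] xs; exists s; apply: thpt_sub xs _ => //; move=> _ ->.
have Ouniq e f : al e = al f -> O e -> O f -> e = f.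
  move=> ef [s xs] [s' xs']; rewrite -ef in xs'.
  exact: (esym (DP_edge _ _ _ _ (thpt_edge_unique _ (FT1 (al e)) _ _ _ _ (NF1 e) xs xs'))).
have key e (F : FT) g s : sval F = [set al e] `|` [set om e] -> al g = om e ->
    NF D (sval F) g -> thpt x F (DP g s) -> O e /\ ~ O (rv e).
  move=> FE ge NFg xs; split.
    have xf := thpt_fold _ (FT1 (al e)) F _ _ (NF1 e) FE xs.
    by have [s' E] := foldp_projT1 e (DP g s) ge; exists s'; rewrite -E.
  move=> Or; have gr : g = rv e by apply: Ouniq => //; exact: FO xs.
  by apply: (proj2 NFg); rewrite FE gr; left; rewrite (tomega_rev tree_of).
have fO : flow (D := D) O.
  split=> // e.
  pose F0 : FT := exist _ _ (fsubtree_edge tree_of e).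
  have [g [s [NFg xs]]] := ns F0.
  have [ga|ga] := proj1 NFg.
    have FE : [set al e] `|` [set om e] = [set al (rv e)] `|` [set om (rv e)].
      by rewrite omega_rev setUC.
    have [Or nO] := key (rv e) F0 g s FE (etrans ga (esym (omega_rev e))) NFg xs.
    by rewrite edge_revK in nO.
  by have [Oe nO] := key e F0 g s erefl ga NFg xs; split=> // /(_ Oe).
have [|xi xiO] := flow_end tree_of O fO.
  move=> v; have [e [s [NFe xs]]] := ns (FT1 v).
  by exists e; split; [case: NFe|exact: FO xs].
exists xi => F; have [e [s [NFe xs]]] := ns F.
by exists e, s; split=> //; apply/xiO; exact: FO xs.
Qed.

(** * Threads converging to vertices *)

(** The points obtained from [u] by folding away from its vertex; there is exactly one over each
    vertex of the tree. *)
Inductive vpt (u : Pt D) : HP -> Prop :=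
| vpt0 : vpt u (KP u)
| vptS e p : vflow (D := D) (projT1 u) e -> projT1 p = om e -> vpt u p -> vpt u (foldp e p).

Lemma projT1_foldp e p : projT1 p = om e -> projT1 (foldp e p) = al e.
Proof. by move=> /foldp_projT1[s ->]. Qed.

Lemma vpt_exists u v : exists p, vpt u p /\ projT1 p = v.
Proof.
have [s0 [ws0 ls0]] := tree_connected tree_of v (projT1 u).
have [s [ws ls _ nd]] := walk_simple (D := D) v s0 ws0; rewrite ls0 in ls.
elim: s v {ws0 ls0 s0} ws ls nd => [|a s IH] v /= ws ls nd.
  by exists (KP u); split; [exact: vpt0|].
move: ws => [[e [ev ea]] ws].
have [|p [up pa]] := IH a ws ls; first by inversion nd.
exists (foldp e p); split; last by rewrite projT1_foldp // pa.
by apply: vptS => //; [exists s; rewrite ev ea|rewrite pa].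
Qed.

Lemma vpt_unique u p q : vpt u p -> vpt u q -> projT1 p = projT1 q -> p = q.
Proof.
move=> up; elim: up q => [|e p' ve pe _ IH] q [|f q' vf qf uq'] //.
- by rewrite projT1_foldp // => E; case: (vflow_sink tree_of _ _ vf).
- by rewrite projT1_foldp // => E; case: (vflow_sink tree_of _ _ ve).
rewrite !projT1_foldp // => ef.
have {}ef : e = f by apply: (proj2 (flow_vflow tree_of (projT1 u))).
by subst f; rewrite (IH q') // pe qf.
Qed.

Lemma vertex_thread u : exists x, stabp x u.
Proof.
pose Q v := sval (cid (vpt_exists u v)).
have uQ v : vpt u (Q v) by case: (svalP (cid (vpt_exists u v))).
have Qv v : projT1 (Q v) = v by case: (svalP (cid (vpt_exists u v))).
have [|v e s|x xP] := thread_of_flow (vflow (D := D) (projT1 u)) Q (flow_vflow tree_of _) Qv.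
- move=> e ve; apply: (vpt_unique u) => //; last by rewrite Qv projT1_foldp.
  by apply: vptS.
- have : vpt u (Q v) := uQ v.
  case=> [/KP_DP[hs _]|f p vf pf _]; first by left.
  have [s' ->] := foldp_projT1 _ _ pf; move=> E; right.
  by rewrite -(DP_edge _ _ _ _ E).
exists x; apply/stabpE; exists (FT1 (projT1 u)) => F Fu.
have g : gate (vflow (D := D) (projT1 u)) (sval F) (projT1 u).
  split; first exact: Fu.
  by move=> e eu ve; case: (vflow_sink tree_of _ _ ve).
rewrite (vpt_unique u (KP u) (Q (projT1 u))) //; first exact: xP.
exact: vpt0.
Qed.

(** * Threads converging to ends *)

Definition isnext (xi : End D) (nxt : Edge Th -> Edge Th) :=
  forall e, al (nxt e) = om e /\ eflow xi (nxt e).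

Lemma next_exists xi : exists nxt, isnext xi nxt.
Proof.
suff /choice[nxt H] : forall e : Edge Th, exists f : Edge Th, al f = om e /\ eflow xi f by exists nxt.
by move=> e; exact: (eflow_step tree_of xi (om e)).
Qed.

(** The [n] edges that follow [e] towards the end, so [e :: ftraj nxt n e] is a path as in the
    fineness condition. *)
Fixpoint ftraj (nxt : Edge Th -> Edge Th) n e : seq (Edge Th) :=
  if n is n'.+1 then nxt e :: ftraj nxt n' (nxt e) else [::].

Lemma size_ftraj nxt n e : size (ftraj nxt n e) = n.
Proof. by elim: n e => //= n IH e; rewrite IH. Qed.

Lemma ftraj_epath xi nxt n e : isnext xi nxt -> eflow xi e -> epath Th e (ftraj nxt n e).
Proof.
move=> nx xe; split.
  elim: n e {xe} => //= n IH e; split; last exact: IH.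
  by case: (nx e).
have [r [xr [r0 r1]]] := xe.
have step k : al (iter k nxt e) = sval r k /\ om (iter k nxt e) = sval r k.+1.
  elim: k => [|k [_ IH]]; first by rewrite r0 r1.
  rewrite iterS; have [an xn] := nx (iter k nxt e).
  have [f [f0 f1]] : adj D (sval r k.+1) (sval r k.+2) by case: (r) => /= ? [].
  suff -> : nxt (iter k nxt e) = f by rewrite -f0 -f1.
  apply: (proj2 (flow_eflow tree_of xi)) => //; first by rewrite f0 -IH.
  have [q [rq qE]] := ray_tail r k.+1.
  exists q; rewrite !qE addn0 addn1 f0 f1; split=> //.
  exact/(end_ray_eq _ _ _ xr).
have E k : map om (ftraj nxt n (iter k nxt e)) = map (sval r) (iota k.+2 n).
  elim: n k => //= n IH k; rewrite -iterS IH.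
  by case: (step k.+1) => _ ->.
have -> : al e :: om e :: map om (ftraj nxt n e) = map (sval r) (iota 0 n.+2).
  have := E 0%N; rewrite /= => ->; by rewrite r0 r1.
by apply: NoDup_map_iota; case: (r) => /= ? [].
Qed.

Lemma fold_dpt e f (h : al f = om e) s :
  foldp e (DP f s) = DP e (delta e (dpt (om e) (exist _ f h) s)).
Proof. by rewrite -foldp_om DPE. Qed.

Lemma dimg_cons e f l s s' : al f = om e -> dimg Th X delta f l s ->
  foldp e (DP f s) = DP e s' -> dimg Th X delta e (f :: l) s'.
Proof.
move=> h ls; rewrite (fold_dpt _ _ h) => /DP_eq <-.
exists (dpt (om e) (exist _ f h) s) => //; exists s; split=> //.
exact: DPE.
Qed.

Lemma dimg_consE e f l s' : dimg Th X delta e (f :: l) s' ->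
  exists s, dimg Th X delta f l s /\ foldp e (DP f s) = DP e s'.
Proof.
move=> [z [s [ls E]] <-]; exists s; split=> //.
by rewrite -foldp_om E.
Qed.

Lemma dimg_neq0 xi nxt n e : isnext xi nxt -> dimg Th X delta e (ftraj nxt n e) !=set0.
Proof.
move=> nx; elim: n e => [|n IH] e /=.
  have [u eu] := Sig_neq0 e; have [s _] := inSig_KP_DP _ _ eu.
  by exists s.
have [s ls] := IH (nxt e); have [h _] := nx e.
exists (delta e (dpt (om e) (exist _ (nxt e) h) s)); apply: (dimg_cons _ _ _ s) => //.
exact: fold_dpt.
Qed.

Lemma dimg_decr xi nxt n m e : isnext xi nxt -> (n <= m)%N ->
  dimg Th X delta e (ftraj nxt m e) `<=` dimg Th X delta e (ftraj nxt n e).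
Proof.
move=> nx; elim: n m e => [|n IH] [|m] e //= nm s' /dimg_consE[s [ls E]].
by apply: (dimg_cons _ _ _ s) => //; [case: (nx e)|exact: IH ls].
Qed.

Lemma fold_dpt_continuous e f (h : al f = om e) (O : set (Delta Th X e)) : f <> rv e ->
  open O -> exists P, open P /\
    forall s, P s <-> O (delta e (dpt (om e) (exist _ f h) s)).
Proof.
move=> fe oO; have [/(_ O oO)[W [oW WE]] _] := proj2 HE e.
have [_ /(_ (exist _ f h)) oP _] := lim_open_hat_basis _ _ oW.
exists (dpt (om e) (exist _ f h) @^-1` W); split=> // s; apply: WE.
apply/hatKeE => s'; rewrite DPE => E; case: fe; exact: DP_edge E.
Qed.

Context {HF : fine_family Th X delta}.

Lemma fine_small xi nxt e (eps : R) : isnext xi nxt -> eflow xi e -> 0 < eps ->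
  exists n, forall a b, dimg Th X delta e (ftraj nxt n e) a ->
    dimg Th X delta e (ftraj nxt n e) b -> ball a eps b.
Proof.
move=> nx xe e0; have [L HL] := finite_list _ (HF e _ e0).
have [N HN] : exists N, forall l, List.In l L -> (size (sval l) <= N)%N.
  elim: L {HL} => [|l L [N IH]]; first by exists 0%N.
  exists (size (sval l) + N)%N => l' [<-|/IH H]; first exact: leq_addr.
  exact: leq_trans H (leq_addl _ _).
exists N.+1 => a b la lb; apply: contrapT => nb.
have ok : ftraj nxt N.+1 e <> [::] /\ epath Th e (ftraj nxt N.+1 e).
  by split=> //; exact: (ftraj_epath xi).
have := HN (exist _ _ ok); rewrite /sval size_ftraj ltnn => H.
by have := H (HL (exist _ _ ok) (ex_intro _ a (ex_intro _ b (conj la (conj lb nb))))).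
Qed.

Lemma fine_unique xi nxt e s s' : isnext xi nxt -> eflow xi e ->
  (forall n, closure (dimg Th X delta e (ftraj nxt n e)) s) ->
  (forall n, closure (dimg Th X delta e (ftraj nxt n e)) s') -> s = s'.
Proof.
move=> nx xe cs cs'; have [hD _] := ext_of e.
apply: (close_eq hD); rewrite ball_close => eps.
have e30 : 0 < (eps%:num / 2 / 2 : R) by rewrite !divr_gt0.
have e20 : 0 < (eps%:num / 2 : R) by rewrite divr_gt0.
have [n small] := fine_small _ _ _ _ nx xe e30.
have [a [la sa]] := cs n _ (nbhsx_ballx s _ e30).
have [b [lb sb]] := cs' n _ (nbhsx_ballx s' _ e20).
rewrite (splitr eps%:num); apply: (@ball_triangle _ _ b); last exact: ball_sym.
rewrite (splitr (eps%:num / 2)); apply: ball_triangle sa _; exact: small.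
Qed.

Lemma closure_fold xi nxt e n s (h : al (nxt e) = om e) : isnext xi nxt -> eflow xi e ->
  closure (dimg Th X delta (nxt e) (ftraj nxt n (nxt e))) s ->
  closure (dimg Th X delta e (ftraj nxt n.+1 e)) (delta e (dpt (om e) (exist _ (nxt e) h) s)).
Proof.
move=> nx xe cs B; rewrite nbhsE => -[O [oO Os] OB].
have ne : nxt e <> rv e.
  by move=> E; have [_] := nx e; rewrite E => /(proj1 (flow_eflow tree_of xi) e).
have [P [oP PE]] := fold_dpt_continuous _ _ h O ne oO.
have [|a [la Pa]] := cs P; first by apply: open_nbhs_nbhs; split=> //; exact/PE.
exists (delta e (dpt (om e) (exist _ (nxt e) h) a)); split; last by apply: OB; apply/PE.
by apply: (dimg_cons _ _ _ a) => //; exact: fold_dpt.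
Qed.

Lemma end_point xi nxt e : isnext xi nxt ->
  exists s, forall n, closure (dimg Th X delta e (ftraj nxt n e)) s.
Proof.
move=> nx; have [_ [cD _]] := ext_of e.
have [a aP] : exists a : nat -> Delta Th X e, forall n, dimg Th X delta e (ftraj nxt n e) (a n).
  suff /choice[a H] : forall n, exists s, dimg Th X delta e (ftraj nxt n e) s by exists a.
  by move=> n; exact: dimg_neq0 nx.
have [s [_ cs]] := cD (a @ \oo) _ filterT.
exists s => n B nB; apply: cs nB.
by exists n => // m /= nm; apply: (dimg_decr xi) (aP m).
Qed.

Lemma end_thread xi : exists x, conv x xi.
Proof.
have [nxt nx] := next_exists xi.
pose s e := sval (cid (end_point xi nxt e nx)).
have sP e n : closure (dimg Th X delta e (ftraj nxt n e)) (s e).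
  exact: (svalP (cid (end_point xi nxt e nx))).
have [out outP] : exists out : Vert Th -> Edge Th, forall v, al (out v) = v /\ eflow xi (out v).
  suff /choice[o H] : forall v : Vert Th, exists e : Edge Th, al e = v /\ eflow xi e by exists o.
  by move=> v; exact: (eflow_step tree_of xi v).
have outE e : eflow xi e -> out (al e) = e.
  by move=> xe; have [h xo] := outP (al e); apply: (proj2 (flow_eflow tree_of xi)).
have fO := flow_eflow tree_of xi.
have [|e xe|v e s' E|x xP] := thread_of_flow (eflow xi) (fun v => DP (out v) (s (out v))) fO.
- by move=> v; case: (outP v).
- have [h xn] := nx e; rewrite outE // (_ : out (om e) = nxt e); last by rewrite -h outE.
  rewrite (fold_dpt _ _ h); congr DP.
  apply: (fine_unique xi nxt) => // -[|n]; first exact: subset_closure.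
  exact: (closure_fold xi).
- by right; rewrite -(DP_edge _ _ _ _ E); case: (outP v).
exists x => F; have [v gv] := gate_exists tree_of _ _ fO (svalP F).
have [h xo] := outP v.
exists (out v), (s (out v)); split=> //; last exact: xP.
by split; [rewrite [talpha _ _]h; case: gv|case: gv => _; exact].
Qed.

Lemma conv_dimg x xi nxt n e s : conv x xi -> isnext xi nxt -> eflow xi e ->
  thpt x (FT1 (al e)) (DP e s) -> dimg Th X delta e (ftraj nxt n e) s.
Proof.
move=> cx nx; elim: n e s => //= n IH e s xe xs.
pose F := FTadd (FT1 (al e)) e erefl.
have [f [s2 [NFf xf xs2 fe]]] := conv_step _ _ (FT1 (al e)) _ cx (NF1 e) xe F erefl.
have [h xn] := nx e.
have ef : f = nxt e by apply: (proj2 (flow_eflow tree_of xi)) => //; exact: (etrans fe (esym h)).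
subst f; apply: (dimg_cons _ _ _ s2) => //.
  apply: IH => //; apply: thpt_sub xs2 _; last by [].
  by move=> v /= ->; right; exact: h.
have xs' := thpt_fold _ (FT1 (al e)) F _ _ (NF1 e) erefl xs2.
have hq' := thpt_hq _ _ _ _ xs' xs.
by apply: hq_projT1 hq' _; rewrite projT1_foldp.
Qed.

Lemma conv_inj x y xi : conv x xi -> conv y xi -> x = y.
Proof.
move=> cx cy; have [nxt nx] := next_exists xi.
apply: thr_ext => F; have [e [s [NFe xe xs]]] := cx F; have [e' [s' [NFe' xe' ys]]] := cy F.
have [_ [_ cF]] := svalP F.
have ee := eflow_NF_unique xi _ _ _ cF NFe NFe' xe xe'; subst e'.
have sub1 : sval (FT1 (al e)) `<=` sval F by move=> v ->; case: NFe.
have xs1 : thpt x (FT1 (al e)) (DP e s) by apply: thpt_sub xs _.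
have ys1 : thpt y (FT1 (al e)) (DP e s') by apply: thpt_sub ys _.
suff ss : s = s' by subst s'; exists (DP e s).
apply: (fine_unique xi nxt e) => // n; apply: subset_closure.
  exact: conv_dimg cx nx xe xs1.
exact: conv_dimg cy nx xe ys1.
Qed.

(** * The homeomorphism *)

Definition holds (x : Thr) (F : FT) (O : set HP) := exists p, thpt x F p /\ O p.

Lemma holdsP x (F : FT) O p : fopen (sval F) O -> thpt x F p -> (holds x F O <-> O p).
Proof.
move=> [_ iO] xp; split=> [[q [xq Oq]]|Op]; last by exists p.
exact: (iO _ _ (thpt_inF _ _ _ xq) (thpt_inF _ _ _ xp) (thpt_hq _ _ _ _ xq xp)).
Qed.

Lemma fopen_sub_holds (F1 F2 : FT) O : sval F1 `<=` sval F2 -> fopen (sval F1) O ->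
  exists O', fopen (sval F2) O' /\ forall x, holds x F2 O' <-> holds x F1 O.
Proof.
move=> F12 fO; have [O' [fO' H]] := fopen_sub _ _ _ F12 fO; exists O'; split=> // x.
have [p1 x1] := thpt_exists x F1; have [p2 x2] := thpt_exists x F2.
by rewrite (holdsP _ _ _ _ fO x1) (holdsP _ _ _ _ fO' x2); exact: H x1 x2.
Qed.

Lemma thr_open_fopen A x : thr_open Th X delta A -> A x -> exists (F : FT) O,
  [/\ fopen (sval F) O, holds x F O & forall y, holds y F O -> A y].
Proof.
move=> oA /oA[Fs [W [fFs [oW [xW WA]]]]].
have [L HL] := finite_list _ fFs.
suff [F [O [fO xO HO]]] : exists (F : FT) O, [/\ fopen (sval F) O, holds x F O &
    forall y, holds y F O -> forall G, List.In G L -> Fs G -> W G (sval y G)].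
  by exists F, O; split=> // y yO; apply: WA => G FG; apply: HO => //; exact: HL.
elim: L {HL} => [|G L [F [O [fO xO HO]]]].
  have [_ [[v] _]] := tree_of; exists (FT1 v), setT; split=> //; first exact: fopenT.
  by have [p xp] := thpt_exists x (FT1 v); exists p.
have [FG|nFG] := EM (Fs G); last by exists F, O; split=> // y yO G' [<-//|]; exact: HO.
have [OG [fOG WG]] := hatF_open_fopen _ _ (oW _ FG).
have WGh y : W G (sval y G) <-> holds y G OG.
  by have [p yp] := thpt_exists y G; rewrite (holdsP _ _ _ _ fOG yp); exact: WG.
have [F2 [FF2 GF2]] := FT_union F G.
have [O1 [fO1 H1]] := fopen_sub_holds _ _ _ FF2 fO.
have [O2 [fO2 H2]] := fopen_sub_holds _ _ _ GF2 fOG.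
have fI := fopenI _ _ _ fO1 fO2.
have hI y : holds y F2 (O1 `&` O2) <-> holds y F O /\ holds y G OG.
  have [p yp] := thpt_exists y F2.
  rewrite -H1 -H2 (holdsP _ _ _ _ fI yp) (holdsP _ _ _ _ fO1 yp) (holdsP _ _ _ _ fO2 yp).
  by [].
exists F2, (O1 `&` O2); split=> //.
  by apply/hI; split=> //; apply/WGh; exact: xW.
by move=> y /hI[yO yG] G' [<- _|G'L]; [exact/WGh|exact: HO].
Qed.

(* The saturated part of an open set of [hat K_F]: a point on a peripheral subspace [Sigma_e]
   leaving [F] is kept only if the whole of [Delta_e] lies in the open set. *)
Definition UO (F : set (Vert Th)) (O : set HP) : set (Pt D) :=
  [set u | [/\ F (projT1 u), O (KP u) &
    forall e, NF D F e -> inSig e u -> forall s, O (DP e s)]].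

Lemma UO_Sig F O e : NF D F e -> (forall s, O (DP e s)) -> tSig D e `<=` sliceU D (UO F O) (al e).
Proof.
move=> NFe Oe x sx.
have eu : inSig e (existT (tK D) (al e) x) by exists x.
split; first by case: NFe.
  by have [s [_ E]] := inSig_KP_DP _ _ eu; rewrite [KP _]E.
by move=> f _ fu; rewrite -(inSig_inj _ _ _ eu fu).
Qed.

Lemma basic_ok_UO (F : FT) O : fopen (sval F) O -> basic_ok D (sval F) (UO (sval F) O).
Proof.
move=> [oO iO]; split; first exact: svalP.
split; first by move=> u [].
split.
  move=> u v [Fu Ou Su] /equivFE[<-//|[e [Fa [Fo g]]]].
  have Fv : sval F (projT1 v) by have [x [_ [_ ->]]] := g.
  split=> //.
    apply: (iO _ _ _ _ _ Ou); [by split=> //; exact: inY_KP|by split=> //; exact: inY_KP|].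
    by right; exists e, u, v.
  move=> f NFf fv; exfalso; apply: (proj2 NFf).
  rewrite (inSig_inj _ _ _ fv (gl_inSigr _ _ _ g)).
  by rewrite (tomega_rev tree_of).
split.
  move=> t Ft; have [K1 _ K3] := lim_open_hat_basis _ _ (oO t Ft).
  apply: open_local => y [_ Oy Sy].
  have [N [l [oN Ny Nl]]] := K3 _ Oy.
  have [M [oM My HM]] := open_avoid (Sg t) l y (Sg_closed t).
  exists (kpt t @^-1` [set z | O (existT hatK t z)] `&` N `&` M); split=> //.
    by apply: openI => //; exact: openI.
  move=> y' [[Oy' Ny'] My']; split=> // e NFe ey' s.
  have et : al e = t by have := inSig_projT1 _ _ ey' => /= ->.
  pose e' : Nt t := exist _ e et.
  have Sy' : Sg t e' y' by apply/SgP.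
  apply: contrapT => nO.
  have el : List.In e' l.
    by apply: (Nl e' y' Ny' Sy') => H; apply: nO; rewrite -(DPE t e'); exact: H.
  have [Se|nSe] := EM (Sg t e' y); last exact: HM el nSe _ My' Sy'.
  by apply: nO; apply: Sy => //; move/SgP: Se.
move=> e NFe.
have [[u [eu Uu]]|no] := EM (exists u, inSig e u /\ UO (sval F) O u).
  by left; apply: UO_Sig => //; case: Uu => _ _; exact.
right; rewrite -subset0 => x [sx Ux]; apply: no.
by exists (existT (tK D) (al e) x); split=> //; exists x.
Qed.

Lemma wU_UO F O p : inF F p -> wU F (UO F O) p -> O p.
Proof.
move=> [Fp Yp] [w1 w2]; have [[u pu]|[e [s pe]]] := HP_case p.
  by rewrite pu; case: (w1 _ pu).
have [Fe|Fe] := EM (F (om e)).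
  have hs := Yp e s Fe pe.
  have pv : p = KP (vphi e s) by rewrite pe; apply/esym/KP_DP.
  by rewrite pv; case: (w1 _ pv).
have NFe : NF D F e by split=> //; move: Fp; rewrite pe.
have Se := w2 _ _ NFe pe; have [u eu] := Sig_neq0 e.
by have [_ _ H] := inSig_slice _ _ _ Se eu; rewrite pe; exact: H.
Qed.

Lemma stab_nbhd x u (F : FT) O : stabp x u -> fopen (sval F) O -> holds x F O ->
  exists (F' : FT) U, [/\ basic_ok D (sval F') U, holds x F' (wU (sval F') U) &
    forall y, holds y F' (wU (sval F') U) -> holds y F O].
Proof.
move=> /stabpE[F0 H] fO xO; have [F1 [FF1 F01]] := FT_union F F0.
have [F2 [F12 F2u]] : exists F2 : FT, sval F1 `<=` sval F2 /\
    forall e, inSig e u -> sval F2 (om e).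
  have [[e eu]|ne] := EM (exists e, inSig e u); last first.
    by exists F1; split=> // e eu; case: ne; exists e.
  have [F2 [F12 F2e]] := FT_union F1 (FT1 (om e)); exists F2; split=> // f fu.
  by rewrite -(inSig_inj _ _ _ eu fu); exact: F2e.
have FF2 : sval F `<=` sval F2 by move=> z /FF1/F12.
have [O' [fO' HO']] := fopen_sub_holds _ _ _ FF2 fO.
have xu : thpt x F2 (KP u) by apply: H => z /F01/F12.
have ok := basic_ok_UO _ _ fO'.
exists F2, (UO (sval F2) O'); split=> //; last first.
  move=> y [p [yp wp]]; apply/HO'; exists p; split=> //.
  exact: wU_UO (thpt_inF _ _ _ yp) wp.
exists (KP u); split=> //; apply: wU_KP => //; split.
- exact: (thpt_in _ _ _ xu).
- by apply/(holdsP _ _ _ _ fO' xu)/HO'.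
- by move=> e [_ nFe] /F2u.
Qed.

Lemma conv_deepen x xi nxt n (F : FT) O e : conv x xi -> isnext xi nxt ->
  fopen (sval F) O -> NF D (sval F) e -> eflow xi e ->
  (forall s, dimg Th X delta e (ftraj nxt n e) s -> O (DP e s)) ->
  exists (F' : FT) O' e', [/\ fopen (sval F') O', NF D (sval F') e', eflow xi e',
    (forall s, O' (DP e' s)) & forall y, holds y F' O' -> holds y F O].
Proof.
move=> cx nx; elim: n F O e => [|n IH] F O e fO NFe xe dO.
  by exists F, O, e; split=> // s; exact: dO.
have [_ [_ cF]] := svalP F.
have [O1 [fO1 H1]] := fopen_fold _ _ _ cF NFe fO.
pose F1 := FTadd F e (proj1 NFe).
have [f [s [NFf xf _ fe]]] := conv_step _ _ _ _ cx NFe xe F1 erefl.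
have [h xn] := nx e.
have ef : f = nxt e.
  by apply: (proj2 (flow_eflow tree_of xi)) => //; exact: (etrans fe (esym h)).
subst f; have [|F' [O' [e' [? ? ? ? H']]]] := IH F1 O1 (nxt e) fO1 NFf xf.
  move=> s1 ds1; apply/H1.
    by split; [case: NFf|apply: inY_DP; case: NFf].
  rewrite (fold_dpt _ _ h); apply: dO; apply: (dimg_cons _ _ _ s1) => //.
  exact: fold_dpt.
exists F', O', e'; split=> // y /H'[p [yp O1p]].
exists (foldp e p); split; first exact: (thpt_fold _ F F1 _ _ NFe erefl yp).
by apply/H1 => //; exact: (thpt_inF _ F1 _ yp).
Qed.

Lemma conv_nbhd x xi (F : FT) O : conv x xi -> fopen (sval F) O -> holds x F O ->
  exists (F' : FT) U, [/\ basic_ok D (sval F') U, holds x F' (wU (sval F') U) &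
    forall y, holds y F' (wU (sval F') U) -> holds y F O].
Proof.
move=> cx fO xO; have [nxt nx] := next_exists xi.
have [e [s [NFe xe xs]]] := cx F.
have oO := fopen_DP _ _ _ fO (proj1 NFe).
have Os : O (DP e s) by apply/(holdsP _ _ _ _ fO xs).
have [eps e0 bO] : exists2 eps : R, 0 < eps & ball s eps `<=` [set s | O (DP e s)].
  by apply/nbhs_ballP; exact: open_nbhs_nbhs.
have [n small] := fine_small _ _ _ _ nx xe e0.
have xs1 : thpt x (FT1 (al e)) (DP e s).
  by apply: thpt_sub xs _ => // v ->; case: NFe.
have [|F' [O' [e' [fO' NFe' xe' O'e' H']]]] := conv_deepen x xi nxt n F O e cx nx fO NFe xe.
  by move=> s1 ds1; apply: bO; apply: small => //; exact: conv_dimg cx nx xe xs1.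
exists F', (UO (sval F') O'); split; first exact: basic_ok_UO.
  have [f [s' [NFf xf xs']]] := cx F'; have [_ [_ cF']] := svalP F'.
  have ef := eflow_NF_unique _ _ _ _ cF' NFe' NFf xe' xf; subst f.
  by exists (DP e' s'); split=> //; apply/wU_DP => //; exact: UO_Sig.
move=> y [p [yp wp]]; apply: H'; exists p; split=> //.
exact: wU_UO (thpt_inF _ _ _ yp) wp.
Qed.

Definition limrel (x : Thr) (z : LimPt D) :=
  match z with
  | inl c => exists u, stabp x u /\ c = qcl (equivF D setT) u
  | inr xi => conv x xi
  end.

Lemma limrel_exists x : exists z, limrel x z.
Proof.
have [[t [y xy]]|/nonstab_conv[xi cx]] := EM (exists t y, stab Th X delta x t y).
  by exists (limK (existT (tK D) t y)), (existT (tK D) t y).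
by exists (inr xi).
Qed.

Lemma stabp_nonconv x u xi : stabp x u -> conv x xi -> False.
Proof. by move=> xu /conv_nonstab; apply; exists (projT1 u), (projT2 u). Qed.

Lemma limrel_unique x z z' : limrel x z -> limrel x z' -> z = z'.
Proof.
case: z z' => [c|xi] [c'|xi'] /=.
- move=> [u [xu ->]] [v [xv ->]]; congr inl; apply/qcl_eq; first exact: crst_equivalence.
  exact: stabp_unique xu xv.
- by move=> [u [xu _]] /(stabp_nonconv _ _ _ xu).
- by move=> cx [u [xu _]]; case: (stabp_nonconv _ _ _ xu cx).
- by move=> c c'; rewrite (conv_unique _ _ _ c c').
Qed.

Lemma limrel_inj x y z : limrel x z -> limrel y z -> x = y.
Proof.
case: z => [c|xi] /=; last exact: conv_inj.
move=> [u [xu ->]] [v [yv /qcl_eq uv]].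
apply: (stabp_inj _ _ v) => //; apply: stabp_equiv xu _.
by apply: uv; exact: crst_equivalence.
Qed.

Lemma limrel_surj z : exists x, limrel x z.
Proof.
case: z => [c|xi]; last exact: end_thread.
have [u ->] := qtP _ c; have [x xu] := vertex_thread u.
by exists x, u.
Qed.

Lemma limrel_Gset x z (F : FT) U : limrel x z -> basic_ok D (sval F) U ->
  (Gset D (sval F) U z <-> holds x F (wU (sval F) U)).
Proof.
move=> xz ok; have [p xp] := thpt_exists x F.
rewrite (holdsP _ _ _ _ (fopen_wU _ _ ok) xp).
by case: z xz => [c [u [xu ->]]|xi cx]; [exact: (Gset_stab _ _ _ _ _ xu ok xp)|exact: (Gset_conv _ _ _ _ _ cx ok xp)].
Qed.

Lemma limrel_nbhd x z (F : FT) O : limrel x z -> fopen (sval F) O -> holds x F O ->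
  exists (F' : FT) U, [/\ basic_ok D (sval F') U, holds x F' (wU (sval F') U) &
    forall y, holds y F' (wU (sval F') U) -> holds y F O].
Proof. by case: z => [c [u [xu _]]|xi]; [exact: stab_nbhd xu|exact: conv_nbhd]. Qed.

Lemma limrel_homeo Phi : (forall x, limrel x (Phi x)) ->
  homeo (thr_open Th X delta) (lim_open D) Phi.
Proof.
move=> PhiP.
have [Psi PsiP] : exists Psi : LimPt D -> Thr, forall z, limrel (Psi z) z.
  suff /choice[f H] : forall z, exists x : Thr, limrel x z by exists f.
  exact: limrel_surj.
have PsiK z : Phi (Psi z) = z by exact: (limrel_unique (Psi z)).
split; [|split].
- by exists Psi => // x; exact: (limrel_inj _ _ (Phi x)).
- move=> O oO x /= /oO[F [U [ok [Gx GO]]]]; have [tF _] := ok.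
  pose F0 : FT := exist _ F tF.
  have fU := fopen_wU _ _ ok; have [oW W] := fopen_hatF_open F0 _ fU.
  have HW (y : Thr) : hatset F (wU F U) (sval y F0) <-> Gset D F U (Phi y).
    have [p yp] := thpt_exists y F0.
    by rewrite (limrel_Gset y _ F0 U (PhiP y) ok) (holdsP _ F0 _ _ fU yp); exact: W.
  exists [set F0], (fun G => hatset (sval G) (wU F U)); split; first exact: finite_set1.
  split; first by move=> _ ->.
  split; first by move=> _ ->; apply/HW.
  by move=> y /(_ F0 erefl)/HW/GO.
- move=> A oA _ [x Ax <-]; have [F [O [fO xO HO]]] := thr_open_fopen _ _ oA Ax.
  have [F' [U [ok xU HU]]] := limrel_nbhd _ _ _ _ (PhiP x) fO xO.
  exists (sval F'), U; split=> //; split; first exact/(limrel_Gset _ _ _ _ (PhiP x) ok).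
  move=> z Gz; exists (Psi z); last exact: PsiK.
  by apply: HO; apply: HU; exact/(limrel_Gset _ _ _ _ (PsiP z) ok).
Qed.

End Ext.
End Points.

Theorem theorem2 (R : realType) (Th : theta R) (X : extsp Th)
  (delta : forall e : Edge Th, hatK Th X (omega Th e) -> Delta Th X e) :
  tree_system Th -> ext_family Th X delta -> fine_family Th X delta ->
  exists Phi : Thr Th X delta -> LimPt (thdata Th),
    homeo (thr_open Th X delta) (lim_open (thdata Th)) Phi /\
    (forall x t y, stab Th X delta x t y ->
       Phi x = inl (qcl (equivF (thdata Th) setT) (existT (K Th) t y))) /\
    (forall x, ~ (exists t y, stab Th X delta x t y) ->
       exists xi, Phi x = inr xi /\ corr Th X delta x xi).
Proof.
move=> HT HE HF.
have [Phi PhiP] : exists Phi : Thr Th X delta -> LimPt (thdata Th), forall x, limrel x (Phi x).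
  suff /choice[f H] : forall x : Thr Th X delta, exists z, limrel x z by exists f.
  exact: limrel_exists.
exists Phi; split; [exact: limrel_homeo|split].
- move=> x t y xy; apply: (limrel_unique x) => //.
  by exists (existT (K Th) t y).
- move=> x ns; have := PhiP x; case: (Phi x) => [c [u [xu _]]|xi cx].
    by case: ns; exists (projT1 u), (projT2 u).
  by exists xi; split=> //; exact: conv_corr.
Qed.
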